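(* For every integer $n \ge 1$ and every $\delta \in \mathbb{R}$, the Hankel determinant $h_{2n} = h_{2n}(\delta)$ satisfies $h_{2n} \neq 0$.
   Context: Let $\Gamma$ be any contour in the complex plane going from $\infty \times e^{5i\pi/6}$ to $\infty \times e^{i\pi/6}$ (for instance the concatenation of the straight half-line from $\infty \times e^{5i\pi/6}$ to $0$ with the straight half-line from $0$ to $\infty\times e^{i\pi/6}$; the integrals below do not depend on the choice). For $\delta\in\mathbb{R}$ and integers $k \ge 0$ define the moments $$\mu_k = \mu_k(\delta) = \int_\Gamma z^k e^{i\left(\frac{z^3}{3} - \delta z\right)}\, dz .$$ For an integer $m\ge 1$ define the Hankel determinant $$h_m = h_m(\delta) = \det\left[\mu_{j+k-2}\right]_{j,k=1,\ldots,m}.$$ *)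

(* Defs.v *)
From mathcomp Require Import all_boot all_order all_algebra.
From mathcomp Require Import all_classical all_reals all_analysis.
From mathcomp.real_closed Require Import complex.

Set Implicit Arguments.
Unset Strict Implicit.
Unset Printing Implicit Defensive.

Import Order.TTheory GRing.Theory Num.Theory.
Import numFieldNormedType.Exports.

Local Open Scope classical_set_scope.
Local Open Scope ring_scope.
Local Open Scope complex_scope.

Definition cexp (R : realType) (z : R[i]) : R[i] :=
  (expR (complex.Re z))%:C *
  (cos (complex.Im z) +i* sin (complex.Im z)).

Definition cmod (R : realType) (z : R[i]) : R := ComplexField.Normc.normc z.

(* Corners are allowed on a locally finite set, so that both the concatenation
   of two half-lines and infinite polygonal lines are covered. *)
Definition piecewise_C1 (R : realType) (g : R -> R) : Prop :=
  continuous g /\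
  exists D : set R,
    [/\ forall a b : R, finite_set (D `&` `[a, b]),
        forall t : R, ~ D t -> derivable g t 1 /\
          {for t, continuous (derive1 g)} &
        forall t : R, D t -> cvg (derive1 g x @[x --> t^'-]) /\
          cvg (derive1 g x @[x --> t^'+])].

(* [gamma] goes to [oo * e^(i theta)] along [F]: its modulus tends to infinity
   and its direction [gamma / |gamma|] tends to [e^(i theta)]. *)
Definition to_infinity_along (R : realType) (F : set_system R)
    (gamma : R -> R[i]) (theta : R) : Prop :=
  [/\ cmod (gamma t) @[t --> F] --> +oo,
      complex.Re (gamma t) / cmod (gamma t) @[t --> F]
        --> cos theta &
      complex.Im (gamma t) / cmod (gamma t) @[t --> F]
        --> sin theta].

Definition contour (R : realType) (gamma : R -> R[i]) : Prop :=
  [/\ piecewise_C1 (fun t => complex.Re (gamma t)),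
      piecewise_C1 (fun t => complex.Im (gamma t)),
      to_infinity_along (ninfty_nbhs R) gamma (5 * pi / 6) &
      to_infinity_along (pinfty_nbhs R) gamma (pi / 6)].

(* At a corner of [gamma] this value is irrelevant: corners are Lebesgue-null. *)
Definition cderive (R : realType) (gamma : R -> R[i]) (t : R) : R[i] :=
  derive1 (fun s => complex.Re (gamma s)) t +i*
  derive1 (fun s => complex.Im (gamma s)) t.

Definition cintegral (R : realType) (f : R -> R[i]) (a b : R) : R[i] :=
  (\int[lebesgue_measure]_(t in `[a, b]) complex.Re (f t))%R +i*
  (\int[lebesgue_measure]_(t in `[a, b]) complex.Im (f t))%R.

(* Improper (possibly conditionally convergent) integral: limit of the
   integrals over [a, b] as a -> -oo and b -> +oo independently. Absolute
   integrability is not required, since a contour may oscillate wildly. *)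
Definition improper_cintegral (R : realType) (f : R -> R[i]) : R[i] :=
  let F := filter_prod (ninfty_nbhs R) (pinfty_nbhs R) in
  lim (complex.Re (cintegral f ab.1 ab.2) @[ab --> F]) +i*
  lim (complex.Im (cintegral f ab.1 ab.2) @[ab --> F]).

Definition contour_integral (R : realType) (gamma : R -> R[i])
    (f : R[i] -> R[i]) : R[i] :=
  improper_cintegral (fun t => f (gamma t) * cderive gamma t).

Definition moment (R : realType) (gamma : R -> R[i]) (delta : R) (k : nat) :
    R[i] :=
  contour_integral gamma
    (fun z => z ^+ k * cexp ('i%C * (z ^+ 3 / 3%:R - delta%:C * z))).

(* Ordinals start at 0, so mu_(j+k-2) for 1 <= j, k <= m becomes mu_(j+k). *)
Definition hankel_det (R : realType) (gamma : R -> R[i]) (delta : R) (m : nat) :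
    R[i] :=
  \det (\matrix_(j < m, k < m) moment gamma delta (j + k)).

(* Main.v *)
(** With [w = y + i x] for [z = x + i y], the integrand is [i^k] times the
    conjugate of [f_k(w) = w^k exp(w^3/3 + delta w)].  The primitive
    [F_k(w) = int_0^1 f_k(t w) w dt] has a limit [L_k] at infinity in the sector
    [1 <= Re w <= Im w] and satisfies [F_k(conj w) = conj (F_k w)]; hence
    [mu_k = 2 i^k nu_k] with [nu_k = Im L_k] real, whatever the contour.  Writing
    [nu_k] as an integral along a vertical line gives [nu_k' = nu_(k+1)] and
    [k nu_(k-1) + delta nu_k + nu_(k+2) = 0].

    Put [H_m = det (nu_(j+k))].  Applying the recurrence to the derivative of a
    product of two consecutive orthogonal polynomials, in the division-free form of
    bordered determinants, yields
    [(m+1) H_(m+1)^2 + H_m H_(m+2)' - H_m' H_(m+2) = 0].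
    So if [H_(2n)] never vanishes, [H_(2n+2) / H_(2n)] is nonincreasing in [delta].
    On the line through the saddle point, i.e. [delta = - a^2] and [w = a + i b s]
    with [a b^2 = 1], the moments are up to an affine change of variable a
    perturbation of Gaussian ones as [b -> 0]; thus the ratio tends to [0] at
    [-oo] and [H_(2n+2)] has no zero near [-oo].  A zero of [H_(2n+2)] would force
    the ratio to vanish identically to its left, a contradiction. *)

From HB Require Import structures.
Require Import Defs.
From mathcomp Require Import all_boot all_order all_algebra.
From mathcomp Require Import all_classical all_reals all_analysis.
From mathcomp.real_closed Require Import complex.
From mathcomp Require Import perm measurable_realfun ring lra.

Set Implicit Arguments.
Unset Strict Implicit.
Unset Printing Implicit Defensive.

Import Order.TTheory GRing.Theory Num.Theory.
Import numFieldNormedType.Exports.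

Local Open Scope classical_set_scope.
Local Open Scope ring_scope.
Local Open Scope complex_scope.

(** * Algebra of Hankel determinants *)

Definition hdet (K : comNzRingType) (nu : nat -> K) (m : nat) : K :=
  \det (\matrix_(i < m, j < m) nu (i + j)%N).

(* If [nu k] depends on a parameter with derivative [nu k.+1], this is the
   derivative of [hdet nu m]: all other rows of the derivative cancel. *)
Definition hdet' (K : comNzRingType) (nu : nat -> K) (m : nat) : K :=
  if m is n.+1 then
    \det (\matrix_(i < n.+1, j < n.+1)
            nu ((if i == ord_max then n.+1 else i) + j)%N)
  else 0.

Section HankelAlgebra.
Variables (K : comNzRingType) (nu : nat -> K).
Implicit Types (p q : {poly K}) (m n k : nat).

(** The moment functional of [nu], extended linearly from ['X^k] to [nu k]. The Hankel matrix is the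
    Gram matrix of the monomials for the pairing [momf (p * q)]. *)
Definition momf p : K := \sum_(i < size p) p`_i * nu i.

Lemma momfE n p : (size p <= n)%N -> momf p = \sum_(i < n) p`_i * nu i.
Proof.
move=> pn; rewrite /momf -(subnKC pn) big_split_ord /=.
rewrite [X in _ = _ + X]big1 ?addr0 // => i _.
by rewrite nth_default ?mul0r ?leq_addr.
Qed.

Lemma momf_is_semilinear : linear_for *%R momf.
Proof.
move=> a p q.
have hp := leq_maxl (size p) (size q); have hq := leq_maxr (size p) (size q).
rewrite (momfE hp) (momfE hq) (@momfE (maxn (size p) (size q))); last first.
  by rewrite (leq_trans (size_polyD _ _)) // geq_max hq (leq_trans (size_scale_leq _ _)).
rewrite mulr_sumr -big_split /=; apply: eq_bigr => i _.
by rewrite coefD coefZ mulrDl mulrA.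
Qed.

HB.instance Definition _ :=
  GRing.isLinear.Build K {poly K} K *%R momf momf_is_semilinear.

Lemma momfXn k : momf 'X^k = nu k.
Proof.
rewrite (@momfE k.+1) ?size_polyXn // big_ord_recr /= big1 ?add0r.
  by rewrite coefXn eqxx mul1r.
by move=> i _; rewrite coefXn ltn_eqF ?mul0r.
Qed.

Lemma momf_mul m n p q : (size p <= m)%N -> (size q <= n)%N ->
  momf (p * q) = \sum_(i < m) \sum_(j < n) p`_i * q`_j * nu (i + j)%N.
Proof.
move=> pm qn.
have pE : p = \sum_(i < m) p`_i *: 'X^i.
  rewrite -poly_def; apply/polyP => i; rewrite coef_poly.
  by case: ltnP => // mi; rewrite nth_default ?(leq_trans pm).
have qE : q = \sum_(i < n) q`_i *: 'X^i.
  rewrite -poly_def; apply/polyP => i; rewrite coef_poly.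
  by case: ltnP => // mi; rewrite nth_default ?(leq_trans qn).
rewrite {1}pE {1}qE mulr_suml raddf_sum; apply: eq_bigr => i _ /=.
rewrite mulr_sumr raddf_sum; apply: eq_bigr => j _ /=.
by rewrite -scalerAl -scalerAr scalerA linearZ /= -exprD momfXn.
Qed.

(* The Hankel determinant of order [m.+1] with last row replaced by the powers
   of ['X]: the orthogonal polynomial of degree [m] scaled by [hdet nu m]. *)
Definition borderp m : {poly K} :=
  \sum_(j < m.+1)
    cofactor (\matrix_(i < m.+1, j < m.+1) nu (i + j)%N) ord_max j *: 'X^j.

Lemma size_borderp m : (size (borderp m) <= m.+1)%N.
Proof.
rewrite (leq_trans (size_sum _ _ _)) //; apply/bigmax_leqP => j _.
by rewrite (leq_trans (size_scale_leq _ _)) // size_polyXn.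
Qed.

Lemma coef_borderp m (j : 'I_m.+1) : (borderp m)`_j =
  cofactor (\matrix_(i < m.+1, j < m.+1) nu (i + j)%N) ord_max j.
Proof.
rewrite /borderp coef_sum (bigD1 j) //= coefZ coefXn eqxx mulr1 big1 ?addr0 //.
by move=> i ij; rewrite coefZ coefXn eq_sym val_eqE (negPf ij) mulr0.
Qed.

(** Expansion along the last row: linearity turns its powers of ['X] into moments, and the factor
    ['X^k] shifts their indices by [k]. *)
Lemma momf_borderp m k : momf (borderp m * 'X^k) =
  \det (\matrix_(i < m.+1, j < m.+1) nu ((if i == ord_max then k else i) + j)%N).
Proof.
rewrite (expand_det_row _ ord_max) /borderp mulr_suml raddf_sum /=.
apply: eq_bigr => j _.
rewrite -scalerAl linearZ /= -exprD momfXn mxE eqxx mulrC addnC.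
congr (_ * (_ * \det _)); apply/matrixP => i l; rewrite !mxE.
by rewrite [_ == ord_max]eq_sym (negPf (neq_lift _ _)).
Qed.

(** Orthogonality to lower degrees: the new last row repeats row [k]. *)
Lemma momf_borderp_lt m k : (k < m)%N -> momf (borderp m * 'X^k) = 0.
Proof.
move=> km; rewrite momf_borderp.
have km1 : (k < m.+1)%N by rewrite ltnS ltnW.
apply: (@determinant_alternate _ _ _ (Ordinal km1) ord_max).
  by rewrite -val_eqE /= ltn_eqF.
by move=> j; rewrite !mxE eqxx -val_eqE /= ltn_eqF.
Qed.

Lemma momf_borderp_max m : momf (borderp m * 'X^m) = hdet nu m.+1.
Proof.
rewrite momf_borderp; congr (\det _); apply/matrixP => i j; rewrite !mxE.
by case: eqP => // ->.
Qed.

(** By orthogonality only the two top coefficients of [p] survive; the pairing of [borderp m] with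
    ['X^m.+1] is exactly [hdet' nu m.+1]. *)
Lemma momf_borderp_mul m p : (size p <= m.+2)%N ->
  momf (borderp m * p) = p`_m * hdet nu m.+1 + p`_m.+1 * hdet' nu m.+1.
Proof.
move=> pm.
have {1}-> : p = \sum_(i < m.+2) p`_i *: 'X^i.
  rewrite -poly_def; apply/polyP => i; rewrite coef_poly.
  by case: ltnP => // mi; rewrite nth_default ?(leq_trans pm).
rewrite mulr_sumr raddf_sum !big_ord_recr /= big1 ?add0r => [|i _].
  by rewrite -!scalerAr !linearZ /= momf_borderp_max momf_borderp.
by rewrite -scalerAr linearZ /= momf_borderp_lt // mulr0.
Qed.

Lemma lead_borderp m : (borderp m)`_m = hdet nu m.
Proof.
rewrite (coef_borderp ord_max) /cofactor -signr_odd addnn odd_double mul1r.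
congr (\det _); apply/matrixP => i j; rewrite !mxE /= /bump.
by rewrite [(m <= i)%N]leqNgt [(m <= j)%N]leqNgt !ltn_ord.
Qed.

(** Deleting the last row and column [m] leaves the transpose of the matrix defining [hdet']; the
    sign of the cofactor is that of the odd number [m.+1 + m]. *)
Lemma sublead_borderp m : (borderp m.+1)`_m = - hdet' nu m.+1.
Proof.
have mm : (m < m.+2)%N by [].
rewrite (coef_borderp (Ordinal mm)) /cofactor -signr_odd /= oddD /=.
rewrite addbb expr1 mulN1r; congr (- _).
rewrite -[LHS]det_tr; congr (\det _); apply/matrixP => i j; rewrite !mxE /=.
rewrite addnC /bump [in X in (_ + X)%N]leqNgt ltn_ord add0n -val_eqE /=.
by case: eqP => [->|/eqP im]; [rewrite leqnn|
  rewrite leqNgt ltn_neqAle im -ltnS ltn_ord].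
Qed.

(* Apply the functional to the derivative of [borderp n.+1 * borderp n]. *)
Lemma hdet_string (a b c : K) n :
  (forall k, k%:R * nu k.-1 + a * nu k + b * nu k.+1 + c * nu k.+2 = 0) ->
  n.+1%:R * hdet nu n.+1 ^+ 2 + b * (hdet nu n * hdet nu n.+2)
  + c * (hdet nu n * hdet' nu n.+2 - hdet' nu n * hdet nu n.+2) = 0.
Proof.
move=> rec.
(* For [p = 'X^k] this is the hypothesis, and linearity extends it to all polynomials: integration
   by parts against the weight, in algebraic form. *)
have Lrec p : momf p^`() + a * momf p + b * momf ('X * p) + c * momf ('X^2 * p) = 0.
  have -> : p = \sum_(i < size p) p`_i *: 'X^i.
    rewrite -poly_def; apply/polyP => i; rewrite coef_poly.
    by case: ltnP => // mi; rewrite nth_default.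
  rewrite (mulr_sumr _ _ _ 'X) (mulr_sumr _ _ _ 'X^2) !raddf_sum /= !mulr_sumr.
  rewrite -!big_split big1 //= => i _.
  rewrite !linearZ /= -!scalerAr !linearZ /= -exprS -exprD !momfXn derivXn.
  rewrite raddfMn /= momfXn -mulr_natl.
  by rewrite -[RHS](mulr0 p`_i) -(rec i); ring.
have := Lrec (borderp n.+1 * borderp n).
have sn := size_borderp n.
have nB : (borderp n)`_n.+1 = 0 by rewrite nth_default.
have nB2 : (borderp n)`_n.+2 = 0 by rewrite nth_default // ltnW.
rewrite derivM raddfD /=.
have sn1 := size_borderp n.+1.
have sd m : (size (borderp m)^`() <= m)%N.
  have [->|p0] := eqVneq (borderp m) 0; first by rewrite deriv0 size_poly0.
  by rewrite -ltnS (leq_trans (lt_size_deriv p0)) ?size_borderp.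
(* The derivative has degree at most [n], so only its top coefficient, [n.+1] times [hdet nu n.+1],
   pairs with [borderp n]. *)
have -> : momf ((borderp n.+1)^`() * borderp n) = n.+1%:R * hdet nu n.+1 ^+ 2.
  rewrite mulrC (@momf_borderp_mul n) ?(leq_trans (sd _)) //.
  rewrite coef_deriv lead_borderp (nth_default _ (sd n.+1)) mul0r addr0.
  by rewrite -[in LHS]mulr_natl -mulrA expr2.
have -> : momf (borderp n.+1 * (borderp n)^`()) = 0.
  rewrite (@momf_borderp_mul n.+1); last by rewrite (leq_trans (sd _)) // leqW // leqW.
  by rewrite !nth_default ?mul0r ?addr0 // (leq_trans (sd _)) // ltnW.
have -> : momf (borderp n.+1 * borderp n) = 0.
  rewrite (@momf_borderp_mul n.+1); last by rewrite (leq_trans sn) // leqW.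
  by rewrite nB nB2 !mul0r addr0.
have -> : momf ('X * (borderp n.+1 * borderp n)) = hdet nu n * hdet nu n.+2.
  rewrite mulrCA (@momf_borderp_mul n.+1).
    by rewrite !coefXM /= nB lead_borderp mul0r addr0.
  by rewrite (leq_trans (size_polyMleq _ _)) // size_polyX /= ltnS (leq_trans sn).
have -> : momf ('X^2 * (borderp n.+1 * borderp n)) =
    hdet nu n * hdet' nu n.+2 - hdet' nu n * hdet nu n.+2.
  rewrite mulrCA (@momf_borderp_mul n.+1).
    rewrite !coefXnM /= [(n.+2 - 2)%N]subn2 lead_borderp addrC; congr (_ + _).
    (* For [n = 0] there is no subleading coefficient, in agreement with the convention
       [hdet' nu 0 = 0]. *)
    by case: (n) => [|k]; rewrite /= ?mul0r ?oppr0 // subn2 /= ?sublead_borderp ?mulNr.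
  by rewrite (leq_trans (size_polyMleq _ _)) // size_polyXn /= !ltnS.
by rewrite mulr0 !addr0.
Qed.

Lemma size_affineX (a b : K) k : (size ((a%:P + b *: 'X) ^+ k) <= k.+1)%N.
Proof.
rewrite (leq_trans (size_poly_exp_leq _ _)) // ltnS -[leqRHS]mul1n leq_mul //.
rewrite -subn1 leq_subLR (leq_trans (size_polyD _ _)) // geq_max.
rewrite (leq_trans (size_polyC_leq1 _)) //.
by rewrite (leq_trans (size_scale_leq _ _)) ?size_polyX.
Qed.

(** The powers of [a + b X] are expanded in monomials by a triangular matrix [B] with diagonal
    entries [b ^+ i], so the new Hankel matrix is [s B A B^T] with [A] the old one. *)
Lemma hdet_affine (nu' : nat -> K) (s a b : K) m :
  (forall k, nu' k = s * momf ((a%:P + b *: 'X) ^+ k)) ->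
  hdet nu' m = s ^+ m * (\prod_(i < m) b ^+ i) ^+ 2 * hdet nu m.
Proof.
move=> nu'E; set e := a%:P + b *: 'X.
have sek k : (size (e ^+ k) <= k.+1)%N by exact: size_affineX.
have lek k : (e ^+ k)`_k = b ^+ k.
  elim: k => [|k IH]; first by rewrite !expr0 coefC.
  rewrite exprS /e mulrDl coefD coefCM -/e [(e ^+ k)`_k.+1]nth_default // mulr0 add0r.
  by rewrite -scalerAl coefZ coefXM /= IH -exprS.
pose B := \matrix_(i < m, j < m) (e ^+ i)`_j.
have detB : \det B = \prod_(i < m) b ^+ i.
  rewrite det_trig; first by apply: eq_bigr => i _; rewrite mxE lek.
  by apply/is_trig_mxP => i j ij; rewrite mxE nth_default // (leq_trans (sek _)).
pose A := \matrix_(i < m, j < m) nu (i + j)%N.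
have -> : s ^+ m * (\prod_(i < m) b ^+ i) ^+ 2 * hdet nu m
    = \det (s *: (B *m A *m B^T)).
  by rewrite detZ !det_mulmx det_tr detB /hdet -/A; ring.
rewrite /hdet; congr (\det _).
apply/matrixP => i j; rewrite !mxE nu'E exprD; congr (_ * _).
rewrite (momf_mul (leq_trans (sek i) (ltn_ord i)) (leq_trans (sek j) (ltn_ord j))).
rewrite exchange_big /=; apply: eq_bigr => k _; rewrite !mxE mulr_suml.
by apply: eq_bigr => l _; rewrite !mxE; ring.
Qed.

End HankelAlgebra.

(** * Differentiation of Hankel determinants in a parameter *)

Section HankelDerivative.
Variable R : realType.

Lemma is_derive_bigsum (I : Type) (r : seq I) (f : I -> R -> R) (df : I -> R) (t : R) :
  (forall i, is_derive t 1 (f i) (df i)) ->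
  is_derive t 1 (fun x => \sum_(i <- r) f i x) (\sum_(i <- r) df i).
Proof.
move=> fd; elim: r => [|i r IH].
  rewrite big_nil (_ : (fun x => _) = cst 0); last by apply/funext => x; rewrite big_nil.
  exact: is_derive_cst.
rewrite big_cons (_ : (fun x => _) = f i + (fun x => \sum_(j <- r) f j x)).
  exact: is_deriveD.
by apply/funext => x; rewrite big_cons.
Qed.

Lemma is_derive_bigprod n (f : 'I_n -> R -> R) (df : 'I_n -> R) (t : R) :
  (forall i, is_derive t 1 (f i) (df i)) ->
  is_derive t 1 (fun x => \prod_i f i x)
    (\sum_i \prod_j (if j == i then df j else f j t)).
Proof.
elim: n f df => [|n IH] f df fd.
  rewrite big_ord0 (_ : (fun x => _) = cst 1); last by apply/funext => x; rewrite big_ord0.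
  exact: is_derive_cst.
rewrite (_ : (fun x => _) = f ord0 * (fun x => \prod_i f (lift ord0 i) x)); last first.
  by apply/funext => x; rewrite big_ord_recl.
have h0 := fd ord0; have h1 := IH _ _ (fun i => fd (lift ord0 i)).
apply: is_derive_eq; rewrite /GRing.scale /= big_ord_recl addrC; congr (_ + _).
  rewrite big_ord_recl eqxx mulrC /=; congr (_ * _).
rewrite mulr_sumr; apply: eq_bigr => i _; rewrite big_ord_recl /=; congr (_ * _).
Qed.

Lemma is_derive_hdet (nu : nat -> R -> R) m (t : R) :
  (forall k, is_derive t 1 (nu k) (nu k.+1 t)) ->
  is_derive t 1 (fun x => hdet (nu^~ x) m) (hdet' (nu^~ t) m).
Proof.
move=> nud.
pose A (i j l : 'I_m) := nu ((if j == i then j.+1 else j) + l)%N t.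
have -> : hdet' (nu^~ t) m = \sum_i \det (\matrix_(j, l) A i j l).
  case: m @A => [|m] A; first by rewrite big_ord0.
  rewrite big_ord_recr /= big1 ?add0r => [|i _].
    by congr (\det _); apply/matrixP => i j; rewrite !mxE /A; case: eqP => [->|].
  (* Row [i], once differentiated, coincides with row [i.+1]. *)
  have im : (i.+1 < m.+1)%N by rewrite ltnS.
  apply: (@determinant_alternate _ _ _ (widen_ord (leqnSn m) i) (Ordinal im)).
    by rewrite -val_eqE /= ltn_eqF.
  by move=> l; rewrite !mxE /A eqxx -!val_eqE /= gtn_eqF.
rewrite (_ : (fun x => _) = (fun x => \sum_(s : 'S_m) (-1) ^+ s *
    \prod_(i < m) nu (i + s i)%N x)); last first.
  by apply/funext => x; apply: eq_bigr => s _; congr (_ * _); apply: eq_bigr => i _; rewrite mxE.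
have -> : \sum_i \det (\matrix_(j, l) A i j l) = \sum_(s : 'S_m) (-1) ^+ s *
    \sum_(i < m) \prod_(j < m) (if j == i then nu (j + s j).+1 t else nu (j + s j)%N t).
  rewrite exchange_big /=; apply: eq_bigr => s _; rewrite mulr_sumr; apply: eq_bigr => i _.
  congr (_ * _); apply: eq_bigr => j _; rewrite mxE /A; by case: eqP.
apply: is_derive_bigsum => s.
have h := is_derive_bigprod (fun i => nud (i + s i)%N).
exact: (is_deriveZ ((-1) ^+ s) h).
Qed.

End HankelDerivative.

(** * Derivatives along curves and holomorphic functions *)

Section CurveDerivative.
Variable R : realType.
Implicit Types (f g : R -> R[i]) (t : R).

Definition cis_derive t f (df : R[i]) : Prop :=
  is_derive t 1 (fun s => complex.Re (f s)) (complex.Re df) /\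
  is_derive t 1 (fun s => complex.Im (f s)) (complex.Im df).

Lemma cReM (x y : R[i]) : complex.Re (x * y) =
  complex.Re x * complex.Re y - complex.Im x * complex.Im y.
Proof. by case: x y => [a b] [c d]. Qed.

Lemma cImM (x y : R[i]) : complex.Im (x * y) =
  complex.Re x * complex.Im y + complex.Im x * complex.Re y.
Proof. by case: x y => [a b] [c d]. Qed.

Lemma cReD (x y : R[i]) : complex.Re (x + y) = complex.Re x + complex.Re y.
Proof. by case: x y => [a b] [c d]. Qed.

Lemma cImD (x y : R[i]) : complex.Im (x + y) = complex.Im x + complex.Im y.
Proof. by case: x y => [a b] [c d]. Qed.

Lemma cis_derive_eq t f df df' : cis_derive t f df -> df = df' -> cis_derive t f df'.
Proof. by move=> ? <-. Qed.

Lemma cis_derive_cst t c : cis_derive t (fun _ => c) 0.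
Proof. by split; exact: is_derive_cst. Qed.

Lemma cis_deriveD t f g df dg : cis_derive t f df -> cis_derive t g dg ->
  cis_derive t (fun s => f s + g s) (df + dg).
Proof.
move=> [f1 f2] [g1 g2]; split; rewrite raddfD /=.
  rewrite (_ : (fun s => _) = (fun s => complex.Re (f s)) + (fun s => complex.Re (g s))).
    exact: is_deriveD.
  by apply/funext => s; rewrite raddfD.
rewrite (_ : (fun s => _) = (fun s => complex.Im (f s)) + (fun s => complex.Im (g s))).
  exact: is_deriveD.
by apply/funext => s; rewrite raddfD.
Qed.

Lemma cis_deriveM t f g df dg : cis_derive t f df -> cis_derive t g dg ->
  cis_derive t (fun s => f s * g s) (df * g t + f t * dg).
Proof.
move=> [f1 f2] [g1 g2]; split.
  rewrite (_ : (fun s => _) = (fun s => complex.Re (f s) * complex.Re (g s)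
    - complex.Im (f s) * complex.Im (g s))); last by apply/funext => s; rewrite cReM.
  apply: is_derive_eq.
  by rewrite cReD !cReM /GRing.scale /=; ring.
rewrite (_ : (fun s => _) = (fun s => complex.Re (f s) * complex.Im (g s)
    + complex.Im (f s) * complex.Re (g s))); last by apply/funext => s; rewrite cImM.
apply: is_derive_eq.
by rewrite cImD !cImM /GRing.scale /=; ring.
Qed.

Lemma cis_deriveX t f df k : cis_derive t f df ->
  cis_derive t (fun s => f s ^+ k) (k%:R * f t ^+ k.-1 * df).
Proof.
move=> hf; elim: k => [|k IH].
  under eq_fun do rewrite expr0; rewrite !mul0r; exact: cis_derive_cst.
under eq_fun do rewrite exprS.
apply: cis_derive_eq (cis_deriveM hf IH) _.
case: k {IH} => [|k] /=; first by rewrite expr0; ring.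
by rewrite -[in RHS]natr1 exprS; ring.
Qed.

Lemma cis_derive_cexp t f df : cis_derive t f df ->
  cis_derive t (fun s => cexp (f s)) (cexp (f t) * df).
Proof.
move=> [f1 f2]; split.
  rewrite (_ : (fun s => _) =
    (fun s => expR (complex.Re (f s)) * cos (complex.Im (f s)))); last first.
    by apply/funext => s; rewrite /cexp cReM /= mul0r subr0.
  apply: is_derive_eq.
  rewrite /cexp !(cReM, cImM) /= /GRing.scale /=; ring.
rewrite (_ : (fun s => _) =
  (fun s => expR (complex.Re (f s)) * sin (complex.Im (f s)))); last first.
  by apply/funext => s; rewrite /cexp cImM /= mul0r addr0.
apply: is_derive_eq.
rewrite /cexp !(cReM, cImM) /= /GRing.scale /=; ring.
Qed.

End CurveDerivative.

(** * Differentiation under the integral sign *)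

Section UnderIntegral.
Variable R : realType.
Notation mu := (@lebesgue_measure R).

Lemma is_derive_under_integral (h dh : R -> R -> R) (G : R -> R) (B : set R) (s0 : R) :
  measurable B ->
  (forall s, mu.-integrable B (EFin \o h s)) ->
  (forall s t : R, is_derive s 1 (h^~ t) (dh s t)) ->
  (forall t, 0 <= G t) -> mu.-integrable B (EFin \o G) ->
  (forall s t, s0 - 1 < s < s0 + 1 -> B t -> `|dh s t| <= G t) ->
  is_derive s0 1 (fun s => \int[mu]_(t in B) h s t)%R (\int[mu]_(t in B) dh s0 t)%R.
Proof.
move=> mB ih hd G0 iG hG.
have I0 : `]s0 - 1, s0 + 1[%classic s0 by rewrite /= in_itv /=; apply/andP; split; lra.
have dE s t : partial1of2 h s t = dh s t.
  by rewrite /partial1of2 derive1E; have := hd s t => /@derive_val.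
have hder (s t : R) : `]s0 - 1, s0 + 1[%classic s -> B t -> derivable (h^~ t) s 1.
  by move=> _ _; have [] := hd s t.
have hle (s t : R) : `]s0 - 1, s0 + 1[%classic s -> B t -> `|partial1of2 h s t| <= G t.
  by rewrite dE /= in_itv /=; exact: hG.
apply: DeriveDef.
  exact: (@derivable_under_integral R _ _ mu h B mB s0 _ _ I0 (fun s _ => ih s) hder G G0 iG hle).
rewrite -derive1E (@differentiation_under_integral R _ _ mu h B mB s0 _ _ I0
  (fun s _ => ih s) hder G G0 iG hle).
by apply: eq_Rintegral => t _; rewrite /= dE.
Qed.

End UnderIntegral.

(** * Holomorphic functions and the Airy-type integrands *)

Section Holomorphic.
Variable R : realType.
Implicit Types (f g : R[i] -> R[i]) (z w : R[i]).
Local Notation normc := (@ComplexField.Normc.normc R).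

Lemma ler_Re_normc w : `|complex.Re w| <= normc w.
Proof.
case: w => a b /=; rewrite -sqrtr_sqr ler_wsqrtr //.
by rewrite lerDl sqr_ge0.
Qed.

Lemma ler_Im_normc w : `|complex.Im w| <= normc w.
Proof.
case: w => a b /=; rewrite -sqrtr_sqr ler_wsqrtr //.
by rewrite lerDr sqr_ge0.
Qed.

Lemma normc_ge0 w : 0 <= normc w.
Proof. by rewrite (le_trans _ (ler_Re_normc w)). Qed.

Lemma normcR (x : R) : normc x%:C = `|x|.
Proof. by rewrite /= expr0n addr0 sqrtr_sqr. Qed.

Lemma normcX w k : normc (w ^+ k) = normc w ^+ k.
Proof.
elim: k => [|k IH]; first by rewrite !expr0 ComplexField.Normc.normc1.
by rewrite !exprS ComplexField.Normc.normcM IH.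
Qed.

Lemma normc_cexp w : normc (cexp w) = expR (complex.Re w).
Proof.
rewrite /cexp ComplexField.Normc.normcM normcR ger0_norm ?expR_ge0 //=.
by rewrite cos2Dsin2 sqrtr1 mulr1.
Qed.

(* [f'] is the complex derivative of [f], tested along differentiable curves. *)
Definition chol f f' := forall (z : R -> R[i]) (t : R) dz,
  cis_derive t z dz -> cis_derive t (fun s => f (z s)) (f' (z t) * dz).

(** Boundedness on every disc, the source of the constant dominating functions and of the local
    Lipschitz bounds. *)
Definition lbounded f := forall r : R, exists2 M, 0 <= M &
  forall w, normc w <= r -> normc (f w) <= M.

Lemma lboundedD f g : lbounded f -> lbounded g -> lbounded (fun w => f w + g w).
Proof.
move=> hf hg r; have [M M0 hM] := hf r; have [N N0 hN] := hg r.
exists (M + N); first exact: addr_ge0.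
by move=> w wr; rewrite (le_trans (le_normcD _ _)) // lerD ?hM ?hN.
Qed.

Lemma lbounded_cst c : lbounded (fun=> c).
Proof. by move=> r; exists (normc c) => //; exact: normc_ge0. Qed.

Lemma lbounded_id : lbounded id.
Proof. by move=> r; exists (`|r|) => // w wr; rewrite (le_trans wr) ?ler_norm. Qed.

Lemma lboundedM f g : lbounded f -> lbounded g -> lbounded (fun w => f w * g w).
Proof.
move=> hf hg r; have [M M0 hM] := hf r; have [N N0 hN] := hg r.
exists (M * N); first exact: mulr_ge0.
by move=> w wr; rewrite ComplexField.Normc.normcM ler_pM ?hM ?hN ?normc_ge0.
Qed.

Lemma lboundedX f k : lbounded f -> lbounded (fun w => f w ^+ k).
Proof.
move=> hf; elim: k => [|k IH].
  by under eq_fun do rewrite expr0; exact: lbounded_cst.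
by under eq_fun do rewrite exprS; exact: lboundedM.
Qed.

Lemma lbounded_cexp f : lbounded f -> lbounded (fun w => cexp (f w)).
Proof.
move=> hf r; have [M M0 hM] := hf r; exists (expR M); first exact: expR_ge0.
move=> w /hM h; rewrite normc_cexp ler_expR (le_trans (ler_norm _)) //.
by rewrite (le_trans (ler_Re_normc _)).
Qed.

Definition airyfun (delta : R) (k : nat) (w : R[i]) : R[i] :=
  w ^+ k * cexp (w ^+ 3 / 3%:R + delta%:C * w).

(** The exponent has derivative [w ^+ 2 + delta], so the derivative of an Airy-type integrand is a
    combination of such integrands. For [k = 0] the coefficient [k%:R] removes the term with the
    truncated index [k.-1]. *)
Definition airyfun' (delta : R) (k : nat) (w : R[i]) : R[i] :=
  k%:R * airyfun delta k.-1 w + delta%:C * airyfun delta k w + airyfun delta k.+2 w.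

Lemma chol_airyfun delta k : chol (airyfun delta k) (airyfun' delta k).
Proof.
move=> z t dz hz.
have h := cis_deriveM (cis_deriveX k hz) (cis_derive_cexp (cis_deriveD
  (cis_deriveM (cis_deriveX 3 hz) (cis_derive_cst t 3%:R^-1))
  (cis_deriveM (cis_derive_cst t delta%:C) hz))).
apply: cis_derive_eq h _; rewrite /airyfun' /airyfun /=.
rewrite mul0r mulr0 !addr0 add0r !exprS.
have e3 : (3%:R : R[i]) != 0 by rewrite pnatr_eq0.
by field.
Qed.

Lemma cholD f f' g g' : chol f f' -> chol g g' ->
  chol (fun w => f w + g w) (fun w => f' w + g' w).
Proof. by move=> hf hg z t dz hz; rewrite mulrDl; apply: cis_deriveD; [apply: hf|apply: hg]. Qed.

Lemma cholZ c f f' : chol f f' -> chol (fun w => c * f w) (fun w => c * f' w).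
Proof.
move=> hf z t dz hz; apply: cis_derive_eq (cis_deriveM (cis_derive_cst t c) (hf _ _ _ hz)) _.
by rewrite mul0r add0r mulrA.
Qed.

Definition airyfun'' delta k w :=
  k%:R * airyfun' delta k.-1 w + delta%:C * airyfun' delta k w + airyfun' delta k.+2 w.

Lemma chol_airyfun' delta k : chol (airyfun' delta k) (airyfun'' delta k).
Proof. by do 2?[apply: cholD]; do ?[apply: cholZ]; exact: chol_airyfun. Qed.

Lemma lbounded_airyfun delta k : lbounded (airyfun delta k).
Proof.
apply: lboundedM; first exact/lboundedX/lbounded_id.
apply/lbounded_cexp/lboundedD; apply: lboundedM.
- exact/lboundedX/lbounded_id.
- exact: lbounded_cst.
- exact: lbounded_cst.
- exact: lbounded_id.
Qed.

Lemma lbounded_airyfun' delta k : lbounded (airyfun' delta k).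
Proof.
have h c j : lbounded (fun w => c * airyfun delta j w).
  exact: lboundedM (lbounded_cst c) (lbounded_airyfun delta j).
exact: (lboundedD (lboundedD (h _ _) (h _ _)) (lbounded_airyfun _ _)).
Qed.

End Holomorphic.

(** * Fundamental theorem and mean value bound on the real line *)

Section RealCalculus.
Variable R : realType.
Notation mu := (@lebesgue_measure R).

Lemma is_derive_continuous (f : R -> R) (t df : R) :
  is_derive t 1 f df -> {for t, continuous f}.
Proof. by move=> [fd _]; exact/differentiable_continuous/derivable1_diffP. Qed.

Lemma integrable_continuous (f : R -> R) (a b : R) :
  continuous f -> mu.-integrable `[a, b] (EFin \o f).
Proof.
move=> cf; apply: continuous_compact_integrable; first exact: segment_compact.
exact: continuous_subspaceT.
Qed.

Lemma Rintegral_FTC2 (F f : R -> R) (a b : R) : a <= b ->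
  (forall t : R, is_derive t 1 F (f t)) -> continuous f ->
  (\int[mu]_(t in `[a, b]) f t)%R = F b - F a.
Proof.
rewrite le_eqVlt => /predU1P[->|ab] dF cf.
  by rewrite set_itv1 Rintegral_set1 subrr.
have cF t : {for t, continuous F} := is_derive_continuous (dF t).
rewrite /Rintegral (@continuous_FTC2 _ f F) //.
- exact: continuous_subspaceT.
- split.
  + by move=> x _; have [] := dF x.
  + exact/cvg_at_right_filter/cF.
  + exact/cvg_at_left_filter/cF.
- by move=> x _; rewrite derive1E; have := dF x => /@derive_val.
Qed.

Lemma MVT_norm_le (F f : R -> R) (a b M : R) :
  (forall t : R, is_derive t 1 F (f t)) ->
  (forall t, Num.min a b <= t <= Num.max a b -> `|f t| <= M) ->
  `|F b - F a| <= M * `|b - a|.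
Proof.
wlog ab : a b / a <= b => [H dF hM|dF hM].
  have [/H h|/ltW/H h] := leP a b; first exact: h.
  rewrite distrC [X in _ <= _ * X]distrC; apply: h => //.
  by rewrite minC maxC.
have [c|c + ->] := @MVT_segment _ F f a b ab (fun t _ => dF t).
  by apply: continuous_subspaceT => t; exact: is_derive_continuous (dF t).
rewrite in_itv /= => cab; rewrite normrM ler_wpM2r ?hM //.
by rewrite (min_idPl ab) (max_idPr ab).
Qed.

End RealCalculus.

(** * Primitives by integration along segments from the origin *)

Section Primitive.
Variable R : realType.
Notation mu := (@lebesgue_measure R).
Local Notation normc := (@ComplexField.Normc.normc R).

Definition cprim (f : R[i] -> R[i]) (w : R[i]) : R[i] :=
  cintegral (fun t => f (t%:C * w) * w) 0 1.

Lemma cis_derive_line (w0 u : R[i]) (t : R) :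
  cis_derive t (fun s => w0 + s%:C * u) u.
Proof.
have h : cis_derive t (fun s : R => s%:C) 1.
  by split; [exact: is_derive_id|exact: is_derive_cst].
apply: cis_derive_eq (cis_deriveD (cis_derive_cst t w0) (cis_deriveM h (cis_derive_cst t u))) _.
by rewrite mulr0 addr0 add0r mul1r.
Qed.

Lemma cis_derive_scale (u : R[i]) (t : R) : cis_derive t (fun s => s%:C * u) u.
Proof.
have := cis_derive_line 0 u t.
by under eq_fun do rewrite add0r.
Qed.

Variables (f f' f'' : R[i] -> R[i]).
Hypotheses (hf : chol f f') (hf' : chol f' f'').
Hypotheses (bf : lbounded f) (bf' : lbounded f').

(** The derivative of the integrand [f (t w) * w] when [w] moves with velocity [u]. *)
Let dh (u w : R[i]) (t : R) := f' (t%:C * w) * (t%:C * u) * w + f (t%:C * w) * u.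

(** The derivative of the integrand in [w] is also an exact derivative in [t], so its integral over
    the unit interval is the boundary value [f w * u]. This identity does the work of Cauchy's
    theorem. *)
Let dh_derive (u w : R[i]) (t : R) :
  cis_derive t (fun t => t%:C * f (t%:C * w) * u) (dh u w t).
Proof.
have h1 : cis_derive t (fun s : R => s%:C) 1.
  by split; [exact: is_derive_id|exact: is_derive_cst].
apply: cis_derive_eq (cis_deriveM (cis_deriveM h1 (hf (cis_derive_scale w t)))
  (cis_derive_cst t u)) _.
by rewrite /dh; ring.
Qed.

Let dh_continuous (u w : R[i]) :
  continuous (fun t => complex.Re (dh u w t)) /\
  continuous (fun t => complex.Im (dh u w t)).
Proof.
have h t := cis_deriveD (cis_deriveM (cis_deriveM (hf' (cis_derive_scale w t))
  (cis_derive_scale u t)) (cis_derive_cst t w))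
  (cis_deriveM (hf (cis_derive_scale w t)) (cis_derive_cst t u)).
by split=> t; have [h1 h2] := h t; [exact: (is_derive_continuous h1)|
  exact: (is_derive_continuous h2)].
Qed.

Let dh_integral (u w : R[i]) : cintegral (dh u w) 0 1 = f w * u.
Proof.
have [c1 c2] := dh_continuous u w.
rewrite /cintegral (Rintegral_FTC2 ler01 (fun t => (dh_derive u w t).1) c1).
rewrite (Rintegral_FTC2 ler01 (fun t => (dh_derive u w t).2) c2).
by rewrite !mul0r !mul1r /= !subr0; case: (f w * u).
Qed.

Lemma cis_derive_cprim_line (w0 u : R[i]) (s0 : R) :
  cis_derive s0 (fun s => cprim f (w0 + s%:C * u)) (f (w0 + s0%:C * u) * u).
Proof.
pose w (s : R) := w0 + s%:C * u.
pose h s t := f (t%:C * w s) * w s.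
have hd s t : cis_derive s (h^~ t) (dh u (w s) t).
  have h1 : cis_derive s (fun s => t%:C * w s) (t%:C * u).
    apply: cis_derive_eq (cis_deriveM (cis_derive_cst s t%:C) (cis_derive_line w0 u s)) _.
    by rewrite mul0r add0r.
  exact: cis_derive_eq (cis_deriveM (hf h1) (cis_derive_line w0 u s)) _.
have hc s t : cis_derive t (h s) (f' (t%:C * w s) * w s * w s).
  apply: cis_derive_eq (cis_deriveM (hf (cis_derive_scale (w s) t)) (cis_derive_cst t (w s))) _.
  by rewrite mulr0 addr0.
(* [r] bounds the modulus of [w s] for [s] within distance 1 of [s0]; [M] and [N] then bound [f] and
   [f'] there, and [K] bounds [dh]. *)
pose r := normc w0 + (`|s0| + 1) * normc u.
have [M M0 hM] := bf r; have [N N0 hN] := bf' r.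
have r0 : 0 <= r by rewrite addr_ge0 ?mulr_ge0 ?addr_ge0 ?normc_ge0.
pose K := N * normc u * r + M * normc u.
have K0 : 0 <= K by rewrite addr_ge0 ?mulr_ge0 ?normc_ge0.
have hK s t : s0 - 1 < s < s0 + 1 -> `[0%R, 1%R]%classic t -> normc (dh u (w s) t) <= K.
  move=> s1; rewrite /= in_itv /= => /andP[t0 t1].
  have wr : normc (w s) <= r.
    rewrite (le_trans (le_normcD _ _)) // lerD2l ComplexField.Normc.normcM normcR.
    rewrite ler_wpM2r ?normc_ge0 // -lerBlDl (le_trans (lerB_dist _ _)) //.
    by rewrite ler_norml; lra.
  have twr : normc (t%:C * w s) <= r.
    rewrite ComplexField.Normc.normcM normcR ger0_norm // (le_trans _ wr) //.
    by rewrite ler_piMl ?normc_ge0.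
  rewrite (le_trans (le_normcD _ _)) // lerD // !ComplexField.Normc.normcM.
    rewrite ler_pM ?mulr_ge0 ?normc_ge0 // ler_pM ?mulr_ge0 ?normc_ge0 ?hN //.
    by rewrite normcR ger0_norm // ler_piMl ?normc_ge0.
  by rewrite ler_wpM2r ?normc_ge0 ?hM.
have iK : mu.-integrable `[0%R, 1%R] (EFin \o cst K).
  by apply: integrable_continuous => x; exact: cvg_cst.
rewrite -dh_integral -/(w s0); split.
- apply: (@is_derive_under_integral _ (fun s t => complex.Re (h s t))
    (fun s t => complex.Re (dh u (w s) t)) (cst K)) => //.
  + by move=> s; apply: integrable_continuous => t; exact: is_derive_continuous (hc s t).1.
  + by move=> s t; exact: (hd s t).1.
  + by move=> s t s1 t1; rewrite (le_trans (ler_Re_normc _)) ?hK.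
- apply: (@is_derive_under_integral _ (fun s t => complex.Im (h s t))
    (fun s t => complex.Im (dh u (w s) t)) (cst K)) => //.
  + by move=> s; apply: integrable_continuous => t; exact: is_derive_continuous (hc s t).2.
  + by move=> s t; exact: (hd s t).2.
  + by move=> s t s1 t1; rewrite (le_trans (ler_Im_normc _)) ?hK.
Qed.

End Primitive.

(** * A chain rule in two real variables *)

Section ChainRule.
Variable R : realType.
Local Notation normc := (@ComplexField.Normc.normc R).

Lemma is_deriveP (f : R -> R) (t l : R) :
  is_derive t 1 f l <-> h^-1 * (f (h + t) - f t) @[h --> 0^'] --> l.
Proof.
have e : (fun h : R => h^-1 *: (f (h *: (1 : R) + t) - f t)) =
         (fun h => h^-1 * (f (h + t) - f t)).
  by apply/funext => h; rewrite /GRing.scale /= mulr1.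
split=> [[d]|h].
  by rewrite -{1}/(derive f t 1) => <-; rewrite /derive /derivable e in d *; exact: d.
have d : derivable f t 1 by rewrite /derivable e; apply/cvg_ex; exists l.
by apply: DeriveDef => //; rewrite /derive e; exact: cvg_lim.
Qed.

(** The increment splits into a move in the first variable at the displaced [y s], controlled by the
    mean value theorem and continuity of [Gp] at the base point, and a move in the second variable
    with the first one frozen, whose derivative is [v]. *)
Lemma is_derive_chain2 (G Gp : R -> R -> R) (x y : R -> R) (t dx v : R) :
  (forall p q : R, is_derive p 1 (G^~ q) (Gp p q)) ->
  (forall e : R, 0 < e -> exists2 d : R, 0 < d & forall p q,
     `|p - x t| < d -> `|q - y t| < d -> `|Gp p q - Gp (x t) (y t)| <= e) ->
  is_derive t 1 x dx -> {for t, continuous y} ->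
  is_derive t 1 (fun s => G (x t) (y s)) v ->
  is_derive t 1 (fun s => G (x s) (y s)) (Gp (x t) (y t) * dx + v).
Proof.
move=> hG hGp hx cy hv.
have cx := is_derive_continuous hx.
(* The difference quotient in the first variable; its value where [x s = x t] makes [DE] hold
   everywhere and [D] tend to [Gp (x t) (y t)]. *)
pose D s := if x s == x t then Gp (x t) (y t)
  else (G (x s) (y s) - G (x t) (y s)) / (x s - x t).
have DE s : G (x s) (y s) - G (x t) (y s) = D s * (x s - x t).
  rewrite /D; case: eqP => [->|/eqP ne]; first by rewrite !subrr mulr0.
  by rewrite divfK // subr_eq0.
have D0 : D (h + t) @[h --> 0^'] --> Gp (x t) (y t).
  have shift0 : h + t @[h --> (0:R)^'] --> t.
    rewrite -[X in _ --> X]add0r; apply: cvgD; last exact: cvg_cst.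
    exact: cvg_within.
  apply/cvgrPdist_le => e e0; have [d d0 hd] := hGp _ e0.
  have nx : \forall h \near (0:R)^', `|x (h + t) - x t| < d.
    have /cvgrPdist_lt/(_ _ d0) := cvg_comp _ _ shift0 cx.
    by apply: filterS => h; rewrite distrC.
  have ny : \forall h \near (0:R)^', `|y (h + t) - y t| < d.
    have /cvgrPdist_lt/(_ _ d0) := cvg_comp _ _ shift0 cy.
    by apply: filterS => h; rewrite distrC.
  apply: filterS2 nx ny => h hx' hy'.
  rewrite /D; case: eqP => [_|/eqP ne]; first by rewrite subrr normr0 ltW.
  set q := y (h + t).
  (* Subtracting the expected linear part leaves a function of [p] whose derivative is small near
     the base point. *)
  have H (p : R) : is_derive p 1 (fun p => G p q - Gp (x t) (y t) * p)
      (Gp p q - Gp (x t) (y t)).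
    have i1 := hG p q.
    have i2 : is_derive p 1 (fun p : R => Gp (x t) (y t) * p) (Gp (x t) (y t)).
      have := is_deriveZ (Gp (x t) (y t)) (is_derive_id p (1:R)).
      by rewrite /GRing.scale /= mulr1.
    exact: is_deriveB.
  have ne0 : x (h + t) - x t != 0 by rewrite subr_eq0.
  rewrite distrC -(@ler_pM2r _ `|x (h + t) - x t|) ?normr_gt0 // -normrM mulrBl divfK //.
  rewrite (_ : _ - _ = G (x (h + t)) q - Gp (x t) (y t) * x (h + t)
    - (G (x t) q - Gp (x t) (y t) * x t)); last by ring.
  apply: (MVT_norm_le H).
  move=> p hp; apply: hd => //.
  apply: le_lt_trans hx'.
  have [l|l] := leP (x t) (x (h + t)).
    rewrite (min_idPl l) (max_idPr l) in hp.
    by rewrite !ger0_norm; lra.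
  rewrite (min_idPr (ltW l)) (max_idPl (ltW l)) in hp.
  by rewrite !ler0_norm; lra.
apply/is_deriveP.
rewrite (_ : (fun h => _) = (fun h => D (h + t) * (h^-1 * (x (h + t) - x t)) +
    h^-1 * (G (x t) (y (h + t)) - G (x t) (y t)))); last first.
  apply/funext => h; rewrite mulrCA -DE -mulrDr; congr (_ * _); ring.
by apply: cvgD; [apply: cvgM D0 _; exact/is_deriveP|exact/is_deriveP].
Qed.

End ChainRule.

(** * Holomorphy of the primitive *)

Section CprimHolomorphic.
Variable R : realType.
Implicit Types (w : R[i]).
Local Notation normc := (@ComplexField.Normc.normc R).

(** The mean value bound on the segment from [w0] to [w], which stays in the disc of radius
    [normc w0 + 1] about the origin. *)
Lemma chol_lipschitz (f f' : R[i] -> R[i]) w0 : chol f f' -> lbounded f' ->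
  exists2 M, 0 <= M & forall w, normc (w - w0) <= 1 ->
    `|complex.Re (f w) - complex.Re (f w0)| <= M * normc (w - w0) /\
    `|complex.Im (f w) - complex.Im (f w0)| <= M * normc (w - w0).
Proof.
move=> hf bf'; have [M M0 hM] := bf' (normc w0 + 1); exists M => // w w1.
have hd t := hf _ _ _ (cis_derive_line w0 (w - w0) t).
have hb (t : R) : Num.min 0 1 <= t <= Num.max 0 1 ->
    normc (f' (w0 + t%:C * (w - w0)) * (w - w0)) <= M * normc (w - w0).
  rewrite (min_idPl ler01) (max_idPr ler01) => /andP[t0 t1].
  rewrite ComplexField.Normc.normcM ler_wpM2r ?normc_ge0 // hM //.
  rewrite (le_trans (le_normcD _ _)) // lerD2l ComplexField.Normc.normcM normcR ger0_norm //.
  by rewrite mulr_ile1 ?normc_ge0.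
have := MVT_norm_le (fun t => (hd t).1) (fun t ht => le_trans (ler_Re_normc _) (hb t ht)).
have := MVT_norm_le (fun t => (hd t).2) (fun t ht => le_trans (ler_Im_normc _) (hb t ht)).
rewrite !mul0r !mul1r !addr0 subr0 normr1 mulr1.
by rewrite [w0 + _]addrC subrK.
Qed.

Lemma normc_le_ReIm (w : R[i]) : normc w <= `|complex.Re w| + `|complex.Im w|.
Proof.
case: w => a b; rewrite /= -[leRHS]ger0_norm ?addr_ge0 // -sqrtr_sqr ler_wsqrtr //.
rewrite sqrrD !real_normK ?num_real // lerD2r.
by rewrite lerDl mulrn_wge0 ?mulr_ge0.
Qed.

(** Derivatives along horizontal and vertical lines give the two partial derivatives [f] and
    [f * 'i]; the two-variable chain rule assembles them along any differentiable curve. *)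
Lemma chol_cprim (f f' f'' : R[i] -> R[i]) :
  chol f f' -> chol f' f'' -> lbounded f -> lbounded f' -> chol (cprim f) f.
Proof.
move=> hf hf' bf bf' z t dz [hx hy].
pose x s := complex.Re (z s); pose y s := complex.Im (z s).
have zE s : z s = x s +i* y s by rewrite /x /y; case: (z s).
have hp (p q : R) : cis_derive p (fun p => cprim f (p +i* q)) (f (p +i* q)).
  have e (s : R) : 0 +i* q + s%:C * 1 = s +i* q.
    by rewrite mulr1; simpc; rewrite ?add0r ?addr0.
  have := cis_derive_cprim_line hf hf' bf bf' (0 +i* q) 1 p.
  by rewrite mulr1 e; under eq_fun => s do rewrite e.
have hq (p q : R) : cis_derive q (fun q => cprim f (p +i* q)) (f (p +i* q) * 'i%C).
  have e (s : R) : p +i* 0 + s%:C * 'i%C = p +i* s.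
    by simpc; rewrite ?mulr0 ?mulr1 ?mul0r ?add0r ?addr0 ?subr0.
  have := cis_derive_cprim_line hf hf' bf bf' (p +i* 0) 'i%C q.
  by rewrite e; under eq_fun => s do rewrite e.
have cf (w0 : R[i]) (e : R) : 0 < e -> exists2 d : R, 0 < d & forall p q : R,
     `|p - complex.Re w0| < d -> `|q - complex.Im w0| < d ->
     `|complex.Re (f (p +i* q)) - complex.Re (f w0)| <= e /\
     `|complex.Im (f (p +i* q)) - complex.Im (f w0)| <= e.
  move=> e0; have [M M0 hM] := chol_lipschitz w0 hf bf'.
  (* The first bound keeps the point in the unit disc about [w0], where the Lipschitz estimate
     holds; the second makes that estimate at most [e], with [M + 1] in place of [M] to divide by a
     positive number. *)
  exists (Num.min (1 / 2) (e / (2 * (M + 1)))).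
    by rewrite lt_min !divr_gt0 // mulr_gt0 // ltr_wpDl.
  move=> p q; rewrite !lt_min => /andP[p1 p2] /andP[q1 q2].
  have nl : normc (p +i* q - w0) <= `|p - complex.Re w0| + `|q - complex.Im w0|.
    by rewrite (le_trans (normc_le_ReIm _)) //; case: (w0).
  have n1 : normc (p +i* q - w0) <= 1 by rewrite (le_trans nl) //; lra.
  have n2 : M * normc (p +i* q - w0) <= e.
    apply: (@le_trans _ _ ((M + 1) * (e / (2 * (M + 1)) + e / (2 * (M + 1))))).
      rewrite ler_pM ?normc_ge0 ?lerDl // (le_trans nl) // lerD // ltW //.
    rewrite le_eqVlt; apply/orP; left; apply/eqP; field.
    by rewrite gt_eqF // ltr_wpDl.
  by have [h1 h2] := hM _ n1; split; [exact: le_trans h1 _|exact: le_trans h2 _].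
have cy : {for t, continuous y} := is_derive_continuous hy.
split.
- have -> : complex.Re (f (z t) * dz) = complex.Re (f (x t +i* y t)) * complex.Re dz
      + complex.Im dz * complex.Re (f (x t +i* y t) * 'i%C).
    by rewrite -zE !cReM /=; ring.
  rewrite (_ : (fun s => _) = fun s => complex.Re (cprim f (x s +i* y s))); last first.
    by apply/funext => s; rewrite zE.
  apply: (@is_derive_chain2 _ (fun p q => complex.Re (cprim f (p +i* q)))
     (fun p q => complex.Re (f (p +i* q)))) => //.
  + by move=> p q; exact: (hp p q).1.
  + move=> e e0; have [d d0 hd] := cf (z t) _ e0; exists d => // p q p1 q1.
    by rewrite -zE; have [] := hd p q p1 q1.
  + have h1 := (hq (x t) (y t)).1.
    rewrite mulrC; exact: (@is_derive1_comp _ (fun q => complex.Re (cprim f (x t +i* q))) y).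
- have -> : complex.Im (f (z t) * dz) = complex.Im (f (x t +i* y t)) * complex.Re dz
      + complex.Im dz * complex.Im (f (x t +i* y t) * 'i%C).
    by rewrite -zE !cImM /=; ring.
  rewrite (_ : (fun s => _) = fun s => complex.Im (cprim f (x s +i* y s))); last first.
    by apply/funext => s; rewrite zE.
  apply: (@is_derive_chain2 _ (fun p q => complex.Im (cprim f (p +i* q)))
     (fun p q => complex.Im (f (p +i* q)))) => //.
  + by move=> p q; exact: (hp p q).2.
  + move=> e e0; have [d d0 hd] := cf (z t) _ e0; exists d => // p q p1 q1.
    by rewrite -zE; have [] := hd p q p1 q1.
  + have h1 := (hq (x t) (y t)).2.
    rewrite mulrC; exact: (@is_derive1_comp _ (fun q => complex.Im (cprim f (x t +i* q))) y).
Qed.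

End CprimHolomorphic.

(** * Decay and limits of the Airy-type primitives *)

Section ExponentialDomination.
Variable R : realType.
Notation mu := (@lebesgue_measure R).

Lemma continuous_expRN : continuous (fun s : R => expR (- s)).
Proof. by move=> s; apply: continuous_comp; [exact: continuousN|exact: continuous_expR]. Qed.

Lemma integral_expRN (T : R) :
  (\int[mu]_(s in `[T, +oo[) (expR (- s))%:E = (expR (- T))%:E)%E.
Proof.
have dF (x : R) : is_derive x 1 (fun s : R => - expR (- s)) (expR (- x)).
  by apply: is_derive_eq; rewrite mulrN1 opprK.
rewrite (@ge0_continuous_FTC2y _ _ (fun s => - expR (- s)) _ 0) //.
- by rewrite EFinN oppeK add0e.
- by apply: continuous_subspaceT; exact: continuous_expRN.
- by rewrite -oppr0; apply: cvgN; exact: cvgr_expR.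
- by apply: cvg_at_right_filter; exact: is_derive_continuous (dF T).
- by move=> x _; rewrite derive1E; have := dF x => /@derive_val.
Qed.

Lemma integrable_expRN (T C : R) :
  mu.-integrable `[T, +oo[ (EFin \o (fun s => C * expR (- s))).
Proof.
have -> : EFin \o (fun s => C * expR (- s)) = (fun s => (C%:E * (expR (- s))%:E)%E).
  by apply/funext => s; rewrite /= EFinM.
apply: integrableZl => //; apply/integrableP; split.
  apply/measurable_EFinP; apply: measurable_funTS.
  exact: continuous_measurable_fun continuous_expRN.
under eq_integral do rewrite /= ger0_norm ?expR_ge0 //.
by rewrite integral_expRN ltry.
Qed.

Lemma integrable_exp_dominated (h : R -> R) (C : R) : continuous h ->
  (forall s, 0 <= s -> `|h s| <= C * expR (- s)) ->
  mu.-integrable `[0%R, +oo[ (EFin \o h).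
Proof.
move=> ch hh; apply: le_integrable (integrable_expRN 0 C) => //.
  by apply/measurable_EFinP/measurable_funTS; exact: continuous_measurable_fun.
move=> s /=; rewrite in_itv /= andbT => s0.
by rewrite lee_fin (le_trans (hh _ s0)) ?ler_norm.
Qed.

(** The tail beyond [T] is at most the integral of [C * expR (- s)] there, which is
    [C * expR (- T)]. *)
Lemma cvg_integral_exp_dominated (h : R -> R) (C : R) : continuous h ->
  (forall s, 0 <= s -> `|h s| <= C * expR (- s)) ->
  (\int[mu]_(s in `[0, T]) h s)%R @[T --> +oo] --> (\int[mu]_(s in `[0, +oo[) h s)%R.
Proof.
move=> ch hh; have ih := integrable_exp_dominated ch hh.
have tail : (fun T => C * expR (- T)) @ +oo --> (0 : R).
  by rewrite -(mulr0 C); apply: cvgM; [exact: cvg_cst|exact: cvgr_expR].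
apply/cvgrPdist_le => e e0.
move/cvgrPdist_le : tail => /(_ _ e0).
apply: filterS2 (nbhs_pinfty_ge (num_real 0)) => T T0; rewrite sub0r normrN => hT.
rewrite (@Rintegral_itvB _ h (BLeft 0) (BInfty _ false) T ih) //.
have sub : `]T, +oo[%classic `<=` `[0%R, +oo[%classic.
  by move=> x /=; rewrite !in_itv /= !andbT => /ltW; exact: le_trans.
have sub2 : `]T, +oo[%classic `<=` `[T, +oo[%classic.
  by move=> x /=; rewrite !in_itv /= !andbT => /ltW.
have ihT : mu.-integrable `]T, +oo[ (EFin \o h) by exact: integrableS ih.
have iC : mu.-integrable `]T, +oo[ (EFin \o (fun s => C * expR (- s))).
  exact: integrableS (integrable_expRN T C).
rewrite (le_trans (le_normr_Rintegral _ ihT)) //.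
apply: le_trans hT; apply: le_trans (ler_norm _).
apply: (@le_trans _ _ (\int[mu]_(s in `]T, +oo[) (C * expR (- s)))%R).
  apply: le_Rintegral => //.
    by move/integrable_norm: ihT.
  by move=> x /=; rewrite in_itv /= andbT => /ltW /(le_trans T0) /hh.
rewrite Rintegral_itv_obnd_cbnd // RintegralZl //; last first.
  have := integrable_expRN T 1.
  by under [X in _ \o X]eq_fun do rewrite mul1r.
by rewrite /Rintegral integral_expRN.
Qed.

End ExponentialDomination.

(** * Size of the Airy-type integrands *)

Section Growth.
Variable R : realType.
Notation mu := (@lebesgue_measure R).
Local Notation normc := (@ComplexField.Normc.normc R).

(** Moves the polynomial factor into the exponent, where it is beaten by a quadratic term; it rests
    on [y <= 1 + y <= expR y]. *)
Lemma exprn_le_expR (x y : R) k : 0 <= x -> x <= y -> x ^+ k <= expR (k%:R * y).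
Proof.
move=> x0 xy; rewrite expRM_natl lerXn2r ?nnegrE ?expR_ge0 //.
by rewrite (le_trans xy) // (le_trans _ (expR_ge1Dx y)) // lerDr.
Qed.

Lemma quadratic_bound (B c : R) : 0 < c ->
  exists D, forall s, B * s - c * s ^+ 2 <= D.
Proof.
move=> c0; exists (B ^+ 2 / (4 * c)) => s.
rewrite -subr_ge0 (_ : _ - _ = c * (s - B / (2 * c)) ^+ 2); last first.
  by field; rewrite gt_eqF.
by rewrite mulr_ge0 ?sqr_ge0 // ltW.
Qed.

Lemma normc_airyfun (delta p q : R) k : normc (airyfun delta k (p +i* q)) =
  normc (p +i* q) ^+ k * expR (p ^+ 3 / 3 - p * q ^+ 2 + delta * p).
Proof.
rewrite /airyfun ComplexField.Normc.normcM normcX normc_cexp; congr (_ * expR _).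
have -> : (p +i* q) ^+ 3 / 3%:R = (p ^+ 3 / 3 - p * q ^+ 2) +i* (p ^+ 2 * q - q ^+ 3 / 3).
  have -> : (3%:R : R[i]) = (3 : R)%:C by rewrite rmorph_nat.
  apply: (@mulIf _ (3 : R)%:C); first by rewrite eq_complex /= pnatr_eq0.
  rewrite divfK ?eq_complex /= ?pnatr_eq0 //.
  by rewrite !exprS expr0; simpc; congr (_ +i* _); field.
by rewrite cReD cReM /= mul0r subr0.
Qed.

(** For [1 <= p <= q] the cubic part of the exponent is at most - (2/3) p q^2, hence at most - (2/3)
    q^2. Half of the decay rate 2 later pays for horizontal paths of length up to [q]. *)
Lemma airyfun_region_bound (delta : R) k : exists2 C, 0 <= C &
  forall p q, 1 <= p -> p <= q -> normc (airyfun delta k (p +i* q)) <= C * expR (- 2 * q).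
Proof.
have c0 : 0 < 2 / 3 :> R by lra.
(* The linear coefficient collects the power [w ^+ k] with [normc w <= 2 * q], the term [delta * p],
   and the decay rate 2 to be gained. *)
have [D hD] := quadratic_bound (k%:R * 2 + `|delta| + 2) c0.
exists (expR D); first exact: expR_ge0.
move=> p q p1 pq; have q0 : 0 <= q by lra.
rewrite normc_airyfun.
have nw : normc (p +i* q) <= 2 * q.
  by rewrite (le_trans (normc_le_ReIm _)) //= !ger0_norm; lra.
apply: (le_trans (ler_wpM2r (expR_ge0 _) (exprn_le_expR k (normc_ge0 _) nw))).
rewrite -!expRD ler_expR.
have dp : delta * p <= `|delta| * q.
  by apply: (@le_trans _ _ (`|delta| * p)); [rewrite ler_wpM2r ?ler_norm //; lra|rewrite ler_wpM2l].
have p3 : p ^+ 3 / 3 <= p * q ^+ 2 / 3.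
  by rewrite ler_pM2r ?invr_gt0 // exprS ler_wpM2l ?lerXn2r ?nnegrE //; lra.
have pq2 : q ^+ 2 <= p * q ^+ 2 by rewrite ler_peMl ?sqr_ge0.
have := hD q; nra.
Qed.

(** On the vertical line the exponent contains - a b^2 s^2. Uniformity in [delta <= delta0] is what
    differentiation in [delta] under the integral calls for. *)
Lemma airyfun_line_bound (a b delta0 : R) k : 0 < a -> 0 < b -> exists2 C, 0 <= C &
  forall delta s, delta <= delta0 -> 0 <= s ->
    normc (airyfun delta k (a +i* (b * s))) <= C * expR (- s).
Proof.
move=> a0 b0; have c0 : 0 < a * b ^+ 2 by rewrite mulr_gt0 ?exprn_gt0.
have [D hD] := quadratic_bound (k%:R * b + 1) c0.
exists (expR (k%:R * a + a ^+ 3 / 3 + delta0 * a + D)); first exact: expR_ge0.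
move=> delta s ds s0; have bs0 : 0 <= b * s by rewrite mulr_ge0 // ltW.
rewrite normc_airyfun.
have nw : normc (a +i* (b * s)) <= a + b * s.
  by rewrite (le_trans (normc_le_ReIm _)) //= !ger0_norm // ltW.
apply: (le_trans (ler_wpM2r (expR_ge0 _) (exprn_le_expR k (normc_ge0 _) nw))).
rewrite -!expRD ler_expR.
have da : delta * a <= delta0 * a by rewrite ler_wpM2r // ltW.
have := hD s; have := da; set X := a ^+ 3 / 3; rewrite exprMn; lra.
Qed.

End Growth.

(** * The limit of the primitive at infinity in a sector *)

Section AiryPrimitive.
Variable R : realType.
Notation mu := (@lebesgue_measure R).
Local Notation normc := (@ComplexField.Normc.normc R).

Definition airyprim (delta : R) k := cprim (airyfun delta k).

Lemma chol_airyprim (delta : R) k : chol (airyprim delta k) (airyfun delta k).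
Proof.
exact: (chol_cprim (@chol_airyfun R delta k) (@chol_airyfun' R delta k)
  (@lbounded_airyfun R delta k) (@lbounded_airyfun' R delta k)).
Qed.

Definition airyline (delta : R) k (a b s : R) : R[i] :=
  airyfun delta k (a +i* (b * s)) * (0 +i* b).

(** The limit at infinity along the upward vertical ray from the real point [a]: the value there
    plus the integral along the ray, traversed with speed [b]. *)
Definition airylim (delta : R) k (a b : R) : R[i] := airyprim delta k a%:C +
  ((\int[mu]_(s in `[0, +oo[) complex.Re (airyline delta k a b s))%R +i*
   (\int[mu]_(s in `[0, +oo[) complex.Im (airyline delta k a b s))%R).

Lemma cis_derive_vline (a b : R) t : cis_derive t (fun s => a +i* (b * s)) (0 +i* b).
Proof.
split => /=; first exact: is_derive_cst.
have := is_deriveZ b (is_derive_id t (1:R)).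
by rewrite /GRing.scale /= mulr1.
Qed.

Lemma cis_derive_airyline (delta : R) k (a b t : R) :
  cis_derive t (fun s => airyprim delta k (a +i* (b * s))) (airyline delta k a b t).
Proof. exact: chol_airyprim (cis_derive_vline a b t). Qed.

Lemma continuous_airyline (delta : R) k (a b : R) :
  continuous (fun s => complex.Re (airyline delta k a b s)) /\
  continuous (fun s => complex.Im (airyline delta k a b s)).
Proof.
have h t := cis_deriveM (@chol_airyfun R delta k _ _ _ (cis_derive_vline a b t))
  (cis_derive_cst t (0 +i* b)).
by split=> t; have [h1 h2] := h t; [exact: (is_derive_continuous h1)|
  exact: (is_derive_continuous h2)].
Qed.

Lemma airyline_bound (a b delta0 : R) k : 0 < a -> 0 < b -> exists2 C, 0 <= C &
  forall delta s, delta <= delta0 -> 0 <= s ->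
    normc (airyline delta k a b s) <= C * expR (- s).
Proof.
move=> a0 b0; have [C C0 hC] := airyfun_line_bound delta0 k a0 b0.
exists (C * b); first by rewrite mulr_ge0 // ltW.
move=> delta s hd s0; rewrite ComplexField.Normc.normcM mulrAC.
have -> : normc (0 +i* b) = b by rewrite /= expr0n add0r sqrtr_sqr gtr0_norm.
by rewrite ler_wpM2r ?hC // ltW.
Qed.

Lemma cvg_airyline (delta : R) k (a b : R) : 0 < a -> 0 < b ->
  complex.Re (airyprim delta k (a +i* (b * T))) @[T --> +oo] -->
    complex.Re (airylim delta k a b) /\
  complex.Im (airyprim delta k (a +i* (b * T))) @[T --> +oo] -->
    complex.Im (airylim delta k a b).
Proof.
move=> a0 b0; have [C C0 hC] := airyline_bound delta k a0 b0.
have [c1 c2] := continuous_airyline delta k a b.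
have e0 : a +i* (b * 0) = a%:C by rewrite mulr0.
split; rewrite /airylim (cReD, cImD) /=.
- have lim := cvg_integral_exp_dominated c1 (fun s s0 =>
    le_trans (ler_Re_normc _) (hC delta s (lexx _) s0)).
  apply: cvg_trans (cvgD (cvg_cst (complex.Re (airyprim delta k a%:C))) lim).
  apply: near_eq_cvg; near=> T.
  have T0 : 0 <= T by near: T; exact: nbhs_pinfty_ge.
  have E : (\int[mu]_(s in `[0%R, T]) complex.Re (airyline delta k a b s))%R =
      complex.Re (airyprim delta k (a +i* (b * T))) -
      complex.Re (airyprim delta k (a +i* (b * 0))) :=
    Rintegral_FTC2 T0 (fun t => (cis_derive_airyline delta k a b t).1) c1.
  by rewrite fctE E e0 /cst addrC subrK.
- have lim := cvg_integral_exp_dominated c2 (fun s s0 =>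
    le_trans (ler_Im_normc _) (hC delta s (lexx _) s0)).
  apply: cvg_trans (cvgD (cvg_cst (complex.Im (airyprim delta k a%:C))) lim).
  apply: near_eq_cvg; near=> T.
  have T0 : 0 <= T by near: T; exact: nbhs_pinfty_ge.
  have E : (\int[mu]_(s in `[0%R, T]) complex.Im (airyline delta k a b s))%R =
      complex.Im (airyprim delta k (a +i* (b * T))) -
      complex.Im (airyprim delta k (a +i* (b * 0))) :=
    Rintegral_FTC2 T0 (fun t => (cis_derive_airyline delta k a b t).2) c2.
  by rewrite fctE E e0 /cst addrC subrK.
Unshelve. all: by end_near. Qed.

(** A point of the sector is compared with the point of abscissa 1 at the same height: the
    horizontal segment contributes at most [C * expR (- 2 * q)] times its length, hence at most
    [C * expR (- q)]. *)
Lemma cvg_airyprim_region (T : Type) (F : set_system T) {FF : Filter F}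
    (delta : R) k (p q : T -> R) :
  (\forall x \near F, 1 <= p x <= q x) -> q x @[x --> F] --> +oo ->
  complex.Re (airyprim delta k (p x +i* q x)) @[x --> F] -->
    complex.Re (airylim delta k 1 1) /\
  complex.Im (airyprim delta k (p x +i* q x)) @[x --> F] -->
    complex.Im (airylim delta k 1 1).
Proof.
move=> pq qoo; have [C C0 hC] := airyfun_region_bound delta k.
have [l1 l2] := cvg_airyline delta k (@ltr01 R) (@ltr01 R).
have hline (y t : R) : cis_derive t (fun s => airyprim delta k (s +i* y))
    (airyfun delta k (t +i* y)).
  have h : cis_derive t (fun s => s +i* y) 1.
    by split; [exact: is_derive_id|exact: is_derive_cst].
  by apply: cis_derive_eq (chol_airyprim delta k h) _; rewrite mulr1.
have bnd x y : 1 <= x -> x <= y -> forall t, Num.min 1 x <= t <= Num.max 1 x ->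
    normc (airyfun delta k (t +i* y)) <= C * expR (- 2 * y).
  move=> x1 xy t; rewrite (min_idPl x1) (max_idPr x1) => /andP[t1 tx].
  by apply: hC => //; exact: le_trans xy.
have fin x y : 1 <= x -> x <= y -> C * expR (- 2 * y) * `|x - 1| <= C * expR (- y).
  move=> x1 xy; rewrite -mulrA ler_wpM2l // mulNr mulrC.
  rewrite (_ : - (2 * y) = - y + - y); last by ring.
  rewrite expRD mulrA ler_piMl ?expR_ge0 // expRN ler_pdivrMr ?expR_gt0 // mul1r.
  by rewrite ger0_norm ?subr_ge0 // (le_trans _ (expR_ge1Dx y)); lra.
have tail : C * expR (- q x) @[x --> F] --> (0 : R).
  rewrite -(mulr0 C); apply: cvgM; first exact: cvg_cst.
  exact: cvg_comp qoo (@cvgr_expR R).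
have conv (u : R[i] -> R) (l : R) :
    (fun y => u (airyprim delta k (1 +i* (1 * y)))) @ +oo --> l ->
    (forall x y : R, 1 <= x -> x <= y -> `|u (airyprim delta k (x +i* y)) -
       u (airyprim delta k (1 +i* y))| <= C * expR (- y)) ->
    u (airyprim delta k (p x +i* q x)) @[x --> F] --> l.
  move=> ul hu.
  have ul' := cvg_comp _ _ qoo ul.
  rewrite -[l]addr0.
  have d0 : (fun x => u (airyprim delta k (p x +i* q x)) - u (airyprim delta k (1 +i* q x)))
     @ F --> (0 : R).
    apply/cvgrPdist_le => e e0; move/cvgrPdist_le : tail => /(_ _ e0).
    apply: filterS2 pq => x /andP[p1 pqx]; rewrite !sub0r !normrN => h.
    by rewrite (le_trans (hu _ _ p1 pqx)) // (le_trans (ler_norm _)).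
  apply: cvg_trans (cvgD ul' d0); apply: near_eq_cvg; apply: nearW => x.
  by rewrite /= fctE /= mul1r addrC subrK.
split; [apply: (conv (@complex.Re R) _ l1)|apply: (conv (@complex.Im R) _ l2)].
- move=> x y x1 xy; apply: le_trans (fin x y x1 xy).
  exact: MVT_norm_le (fun t => (hline y t).1)
    (fun t ht => le_trans (ler_Re_normc _) (bnd x y x1 xy t ht)).
- move=> x y x1 xy; apply: le_trans (fin x y x1 xy).
  exact: MVT_norm_le (fun t => (hline y t).2)
    (fun t ht => le_trans (ler_Im_normc _) (bnd x y x1 xy t ht)).
Qed.

(** The ray eventually enters the sector, where the limit is unique. The freedom in [a] and [b]
    later allows the ray to start at the saddle point. *)
Lemma airylim_indep (delta : R) k (a b : R) : 1 <= a -> 0 < b ->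
  airylim delta k a b = airylim delta k 1 1.
Proof.
move=> a1 b0.
have qoo : b * T @[T --> +oo] --> +oo by exact: gt0_cvgMry.
have reg : \forall T \near +oo, 1 <= a <= b * T.
  by near=> T; rewrite a1 /=; near: T; move/cvgryPge : qoo => /(_ a).
have [l1 l2] := cvg_airyline delta k (lt_le_trans ltr01 a1) b0.
have [r1 r2] := cvg_airyprim_region delta k reg qoo.
by apply/eqP; rewrite eq_complex; apply/andP; split; apply/eqP;
  [exact: cvg_unique _ l1 r1|exact: cvg_unique _ l2 r2].
Unshelve. all: by end_near. Qed.

End AiryPrimitive.

(** * The real moments and their Hankel determinants *)

Section AiryConj.
Variable R : realType.
Notation mu := (@lebesgue_measure R).
Local Notation normc := (@ComplexField.Normc.normc R).

Lemma Re_conjc (w : R[i]) : complex.Re w^*%C = complex.Re w.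
Proof. by case: w. Qed.

Lemma Im_conjc (w : R[i]) : complex.Im w^*%C = - complex.Im w.
Proof. by case: w. Qed.

Lemma cexp_conj (w : R[i]) : cexp w^*%C = (cexp w)^*%C.
Proof.
case: w => x y; rewrite /cexp /= cosN sinN.
by simpc.
Qed.

Lemma airyfun_conj (delta : R) k w : airyfun delta k w^*%C = (airyfun delta k w)^*%C.
Proof.
pose cj := @conjc R : {rmorphism R[i] -> R[i]}.
have e3 : w^*%C ^+ 3 / 3%:R + delta%:C * w^*%C = cj (w ^+ 3 / 3%:R + delta%:C * w).
  rewrite rmorphD rmorphM rmorphXn fmorphV rmorph_nat rmorphM.
  by congr (_ + _ * _); rewrite /= oppr0.
by rewrite /airyfun e3 cexp_conj -(rmorphXn cj) -(rmorphM cj).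
Qed.

Lemma airyprim_conj (delta : R) k w : airyprim delta k w^*%C = (airyprim delta k w)^*%C.
Proof.
have e t : airyfun delta k (t%:C * w^*%C) * w^*%C = (airyfun delta k (t%:C * w) * w)^*%C.
  pose cj := @conjc R : {rmorphism R[i] -> R[i]}.
  have -> : t%:C * w^*%C = cj (t%:C * w) by rewrite rmorphM /= oppr0.
  by rewrite airyfun_conj -(rmorphM cj).
have hc t := cis_deriveM (@chol_airyfun R delta k _ _ _ (cis_derive_scale w t))
  (cis_derive_cst t w).
rewrite /airyprim /cprim /cintegral.
rewrite [RHS]/conjc; congr (_ +i* _).
  by apply: eq_Rintegral => t _; rewrite e Re_conjc.
rewrite -mulN1r -RintegralZl //; last first.
  by apply: integrable_continuous => t; exact: is_derive_continuous (hc t).2.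
by apply: eq_Rintegral => t _; rewrite e Im_conjc mulN1r.
Qed.

Lemma Im_airyfunR (delta a : R) k : complex.Im (airyfun delta k a%:C) = 0.
Proof.
have := airyfun_conj delta k a%:C; rewrite conjc_real.
by case: (airyfun _ _ _) => x y /= [] yN; lra.
Qed.

Lemma Im_airyprimR (delta a : R) k : complex.Im (airyprim delta k a%:C) = 0.
Proof.
have := airyprim_conj delta k a%:C; rewrite conjc_real.
by case: (airyprim _ _ _) => x y /= [] yN; lra.
Qed.

End AiryConj.

(** * The real moments: derivative in [delta] and recurrence *)

Section AiryMoment.
Variable R : realType.
Notation mu := (@lebesgue_measure R).
Local Notation normc := (@ComplexField.Normc.normc R).

Lemma integrable_scale (D : set R) (f : R -> R) (c : R) : measurable D ->
  mu.-integrable D (EFin \o f) -> mu.-integrable D (EFin \o (fun x => c * f x)).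
Proof.
move=> mD fi; have -> : EFin \o (fun x => c * f x) = (fun x => (c%:E * (f x)%:E)%E).
  by apply/funext => x; rewrite /= EFinM.
exact: integrableZl.
Qed.

Lemma integrable_add (D : set R) (f g : R -> R) : measurable D ->
  mu.-integrable D (EFin \o f) -> mu.-integrable D (EFin \o g) ->
  mu.-integrable D (EFin \o (fun x => f x + g x)).
Proof.
move=> mD fi gi; have -> : EFin \o (fun x => f x + g x) = ((EFin \o f) \+ (EFin \o g))%E.
  by apply/funext => x; rewrite /= EFinD.
exact: integrableD.
Qed.

Definition airymom (k : nat) (delta : R) : R := complex.Im (airylim delta k 1 1).

(** The endpoint term of [airylim] is the primitive at a real point, whose imaginary part vanishes
    by conjugation symmetry. *)
Lemma airymomE k (delta a b : R) : 1 <= a -> 0 < b ->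
  airymom k delta = (\int[mu]_(s in `[0%R, +oo[) complex.Im (airyline delta k a b s))%R.
Proof.
by move=> a1 b0; rewrite /airymom -(airylim_indep delta k a1 b0) cImD Im_airyprimR add0r.
Qed.

Lemma integrable_airyline (delta a b : R) k : 0 < a -> 0 < b ->
  mu.-integrable `[0%R, +oo[ (EFin \o (fun s => complex.Im (airyline delta k a b s))).
Proof.
move=> a0 b0; have [C C0 hC] := airyline_bound delta k a0 b0.
apply: (@integrable_exp_dominated _ _ C); first exact: (continuous_airyline _ _ _ _).2.
by move=> s s0; rewrite (le_trans (ler_Im_normc _)) ?hC.
Qed.

(** Differentiating the exponential in [delta] produces a factor [w], which raises [k] by one. The
    bound taken up to [delta + 1] dominates throughout the unit window about [delta]. *)
Lemma is_derive_airymom k (delta : R) :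
  is_derive delta 1 (airymom k) (airymom k.+1 delta).
Proof.
rewrite (_ : airymom k = fun d =>
    (\int[mu]_(s in `[0%R, +oo[) complex.Im (airyline d k 1 1 s))%R); last first.
  by apply/funext => d; rewrite (@airymomE k d 1 1).
rewrite (@airymomE k.+1 delta 1 1) //.
have [C C0 hC] := airyline_bound (delta + 1) k.+1 (@ltr01 R) (@ltr01 R).
apply: (@is_derive_under_integral _ (fun d s => complex.Im (airyline d k 1 1 s))
   (fun d s => complex.Im (airyline d k.+1 1 1 s)) (fun s => C * expR (- s))) => //.
- by move=> d; exact: integrable_airyline.
- move=> d s; pose w := 1 +i* (1 * s) : R[i].
  have h1 : cis_derive d (fun d : R => d%:C) 1.
    by split; [exact: is_derive_id|exact: is_derive_cst].
  have h := cis_deriveM (cis_deriveM (cis_derive_cst d (w ^+ k)) (cis_derive_cexp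
    (cis_deriveD (cis_derive_cst d (w ^+ 3 / 3%:R)) (cis_deriveM h1 (cis_derive_cst d w)))))
    (cis_derive_cst d (0 +i* 1 : R[i])).
  have {h} := cis_derive_eq h (_ : _ = airyline d k.+1 1 1 s).
  case=> [|_]; last by [].
  by rewrite /airyline /airyfun -/w [w ^+ k.+1]exprS; ring.
- by move=> s; rewrite mulr_ge0 ?expR_ge0.
- exact: integrable_expRN.
- move=> d s /andP[_ d1]; rewrite /= in_itv /= andbT => s0.
  by rewrite (le_trans (ler_Im_normc _)) ?hC // ltW.
Qed.

(** The left side integrates the imaginary part of the derivative of [airyfun delta k] along the ray
    from 1. The boundary term vanishes at infinity by decay and at 1 because [airyfun] is real on
    the real axis. *)
Lemma airymom_rec k (delta : R) :
  k%:R * airymom k.-1 delta + delta * airymom k delta + airymom k.+2 delta = 0.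
Proof.
have il j := integrable_airyline delta j (@ltr01 R) (@ltr01 R).
have E s : k%:R * complex.Im (airyline delta k.-1 1 1 s) +
    delta * complex.Im (airyline delta k 1 1 s) +
    complex.Im (airyline delta k.+2 1 1 s) =
    complex.Im (airyfun' delta k (1 +i* (1 * s)) * (0 +i* 1)).
  rewrite /airyline /airyfun' !mulrDl !cImD -!mulrA.
  by rewrite -[k%:R : R[i]](rmorph_nat (real_complex R)) ![in RHS](cImM _%:C) /= !mul0r !addr0.
have dE t := @chol_airyfun R delta k _ _ _ (cis_derive_vline 1 1 t).
have ch : continuous (fun s : R => complex.Im (airyfun' delta k (1 +i* (1 * s)) * (0 +i* 1))).
  move=> t; exact: is_derive_continuous (cis_deriveM (@chol_airyfun' R delta k _ _ _
    (cis_derive_vline 1 1 t)) (cis_derive_cst t (0 +i* 1))).2.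
have [C1 C10 hC1] := airyline_bound delta k.-1 (@ltr01 R) (@ltr01 R).
have [C2 C20 hC2] := airyline_bound delta k (@ltr01 R) (@ltr01 R).
have [C3 C30 hC3] := airyline_bound delta k.+2 (@ltr01 R) (@ltr01 R).
have hb (s : R) : 0 <= s ->
    `|complex.Im (airyfun' delta k (1 +i* (1 * s)) * (0 +i* 1))| <=
    (k%:R * C1 + `|delta| * C2 + C3) * expR (- s).
  move=> s0; rewrite -E (le_trans (ler_normD _ _)) // mulrDl lerD //; last first.
    by rewrite (le_trans (ler_Im_normc _)) ?hC3.
  rewrite (le_trans (ler_normD _ _)) // mulrDl !normrM normr_nat -!mulrA lerD //.
    by rewrite ler_wpM2l // (le_trans (ler_Im_normc _)) ?hC1.
  by rewrite ler_wpM2l // (le_trans (ler_Im_normc _)) ?hC2.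
have lim := cvg_integral_exp_dominated ch hb.
have [C C0 hC] := airyfun_line_bound delta k (@ltr01 R) (@ltr01 R).
have lim0 : (\int[mu]_(s in `[0%R, T])
    complex.Im (airyfun' delta k (1 +i* (1 * s)) * (0 +i* 1)))%R @[T --> +oo] --> (0 : R).
  have tail : C * expR (- T) @[T --> +oo] --> (0 : R).
    by rewrite -(mulr0 C); apply: cvgM; [exact: cvg_cst|exact: cvgr_expR].
  apply/cvgrPdist_le => e e0; move/cvgrPdist_le : tail => /(_ _ e0).
  apply: filterS2 (nbhs_pinfty_ge (num_real 0)) => T T0; rewrite !sub0r !normrN => hT.
  rewrite (Rintegral_FTC2 T0 (fun t => (dE t).2) ch) mulr0 (Im_airyfunR delta 1) subr0.
  apply: le_trans hT; apply: le_trans (ler_norm _).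
  by rewrite (le_trans (ler_Im_normc _)) ?hC.
rewrite -(cvg_unique _ lim lim0) // !(@airymomE _ delta 1 1) //.
have s1 := integrable_scale k%:R (measurable_itv _) (il k.-1).
have s2 := integrable_scale delta (measurable_itv _) (il k).
have s12 := integrable_add (measurable_itv _) s1 s2.
rewrite -!RintegralZl // -RintegralD // -RintegralD //.
by apply: eq_Rintegral => s _; rewrite E.
Qed.

End AiryMoment.

(** * Gaussian moments and their Hankel determinants *)

Section GaussianLimit.
Variable R : realType.
Notation mu := (@lebesgue_measure R).
Local Notation normc := (@ComplexField.Normc.normc R).

(* In [w = a + i b s] with [a b^2 = 1], the exponent [w^3/3 - a^2 w] equals
   [- 2 a^3 / 3 - s^2 - i b^3 s^3 / 3]; here [eps] stands for [b^3]. *)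
Definition gaussline (eps : R) (l : nat) (s : R) : R[i] :=
  (0 +i* s) ^+ l * cexp ((- s ^+ 2) +i* (- (eps * s ^+ 3 / 3))) * 'i%C.

Definition gaussmom (eps : R) (l : nat) : R :=
  (\int[mu]_(s in `[0%R, +oo[) complex.Im (gaussline eps l s))%R.

Lemma gaussline_bound l : exists2 C, 0 <= C &
  forall eps s, 0 <= s -> normc (gaussline eps l s) <= C * expR (- s).
Proof.
have [D hD] := quadratic_bound (l%:R + 1) (@ltr01 R).
exists (expR D); first exact: expR_ge0.
move=> eps s s0; rewrite /gaussline 2!ComplexField.Normc.normcM normcX normc_cexp.
have e1 : normc 'i%C = 1 :> R by rewrite /= expr0n expr1n add0r sqrtr1.
have e2 : normc (0 +i* s) = s by rewrite /= expr0n add0r sqrtr_sqr ger0_norm.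
rewrite e1 e2 mulr1 /=.
apply: (le_trans (ler_wpM2r (expR_ge0 _) (exprn_le_expR l s0 (lexx _)))).
by rewrite -!expRD ler_expR; have := hD s; lra.
Qed.

Lemma cis_derive_imag (t : R) : cis_derive t (fun s => 0 +i* s) 'i%C.
Proof. by split; [exact: is_derive_cst|exact: is_derive_id]. Qed.

Lemma is_derive_exprn (t : R) n : is_derive t 1 (fun s : R => s ^+ n) (n%:R * t ^+ n.-1).
Proof.
have := is_deriveX n (is_derive_id t (1:R)).
by rewrite (_ : id ^+ n = fun s : R => s ^+ n) /GRing.scale /= ?mulr1 // fctE.
Qed.

Lemma cis_derive_gaussarg (eps t : R) :
  cis_derive t (fun s => (- s ^+ 2) +i* (- (eps * s ^+ 3 / 3)))
    ((- (2 * t)) +i* (- (eps * t ^+ 2))).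
Proof.
split => /=.
  have := is_deriveN (is_derive_exprn t 2).
  by rewrite expr1.
have := is_deriveN (is_deriveZ (eps / 3) (is_derive_exprn t 3)).
rewrite (_ : (fun s => - (eps * s ^+ 3 / 3)) = - (eps / 3 \*: fun s : R => s ^+ 3)); last first.
  by apply/funext => s; transitivity (- (eps / 3 * s ^+ 3)); [ring|].
by move=> h; apply: (@is_derive_eq _ _ _ _ _ _ _ _ h); rewrite /GRing.scale /=; field.
Qed.

Lemma continuous_gaussline (eps : R) l :
  continuous (fun s => complex.Im (gaussline eps l s)).
Proof.
move=> t; exact: is_derive_continuous (cis_deriveM (cis_deriveM
  (cis_deriveX l (cis_derive_imag t)) (cis_derive_cexp (cis_derive_gaussarg eps t)))
  (cis_derive_cst t 'i%C)).2.
Qed.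

Lemma integrable_gaussline (eps : R) l :
  mu.-integrable `[0%R, +oo[ (EFin \o (fun s => complex.Im (gaussline eps l s))).
Proof.
have [C C0 hC] := gaussline_bound l.
apply: (@integrable_exp_dominated _ _ C); first exact: continuous_gaussline.
by move=> s s0; rewrite (le_trans (ler_Im_normc _)) ?hC.
Qed.

(** Dominated convergence: [eps] enters only through a phase, so the bound of [gaussline_bound] is
    uniform in it. *)
Lemma cvg_gaussmom l : gaussmom eps l @[eps --> (0 : R)] --> gaussmom 0 l.
Proof.
have [C C0 hC] := gaussline_bound l.
have I0 : (0 : R) \in `](-1), 1[%classic.
  by rewrite inE /= in_itv /=; apply/andP; split; lra.
have key := @continuity_under_integral R _ _ mu
  (fun eps s => complex.Im (gaussline eps l s)) `[0%R, +oo[ _ (-1) 1 _ _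
  (fun s => C * expR (- s)) _ _ 0 I0.
apply: key => //.
- by move=> x _; exact: integrable_gaussline.
- apply: aeW => s _ x _ .
  pose w : R[i] := 0 +i* s.
  have ha : cis_derive x (fun e => (- s ^+ 2) +i* (- (e * s ^+ 3 / 3)))
     (0 +i* (- (s ^+ 3 / 3))).
    split => /=; first exact: is_derive_cst.
    have := is_deriveN (is_deriveZ (s ^+ 3 / 3) (is_derive_id x (1:R))).
    rewrite (_ : (fun e => - (e * s ^+ 3 / 3)) = - ((s ^+ 3 / 3) \*: id)); last first.
      by apply/funext => e; transitivity (- (s ^+ 3 / 3 * e)); [ring|].
    by move=> h; apply: (@is_derive_eq _ _ _ _ _ _ _ _ h); rewrite /GRing.scale /= mulr1.
  exact: is_derive_continuous (cis_deriveM (cis_deriveM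
    (cis_derive_cst x (w ^+ l)) (cis_derive_cexp ha)) (cis_derive_cst x 'i%C)).2.
- exact: integrable_expRN.
- move=> x _; apply: aeW => s; rewrite /= in_itv /= andbT => s0.
  by rewrite (le_trans (ler_Im_normc _)) ?hC.
Qed.

(** The derivative of [W s], which is (i s)^l exp(- s^2), is integrated over the half-line; the
    boundary value at 0 is 0 or 1, hence has no imaginary part. *)
Lemma gaussmom0_rec l : l%:R * gaussmom 0 l.-1 + 2 * gaussmom 0 l.+1 = 0.
Proof.
pose W s := (0 +i* s) ^+ l * cexp ((- s ^+ 2) +i* (- (0 * s ^+ 3 / 3))) : R[i].
pose W' s := l%:R * complex.Im (gaussline 0 l.-1 s) + 2 * complex.Im (gaussline 0 l.+1 s).
have dE (t : R) : is_derive t 1 (fun s => complex.Im (W s)) (W' t).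
  have h := cis_deriveM (cis_deriveX l (cis_derive_imag t))
    (cis_derive_cexp (cis_derive_gaussarg 0 t)).
  apply: (@is_derive_eq _ _ _ _ _ _ _ _ h.2); rewrite /W' /gaussline.
  set E := cexp _; set X := 0 +i* t.
  have -> : - (2 * t) +i* - (0 * t ^+ 2) = 2%:R * X * 'i%C.
    rewrite -[2%:R : R[i]](rmorph_nat (real_complex R)) /X.
    by simpc; congr (_ +i* _); ring.
  have -> : l%:R * X ^+ l.-1 * 'i%C * E + X ^+ l * (E * (2%:R * X * 'i%C)) =
     l%:R%:C * (X ^+ l.-1 * E * 'i%C) + 2%:R%:C * (X ^+ l.+1 * E * 'i%C).
    by rewrite !rmorph_nat [X ^+ l.+1]exprS; ring.
  by rewrite cImD !(cImM _%:C) /= !mul0r !addr0.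
have cW' : continuous W'.
  move=> t; apply: cvgD; apply: cvgM; first [exact: cvg_cst|exact: continuous_gaussline].
have [C1 C10 hC1] := gaussline_bound l.-1.
have [C2 C20 hC2] := gaussline_bound l.+1.
have [C C0 hC] := gaussline_bound l.
have hb (s : R) : 0 <= s -> `|W' s| <= (l%:R * C1 + 2 * C2) * expR (- s).
  move=> s0; apply: (le_trans (ler_normD _ _)); rewrite [leRHS]mulrDl.
  by apply: lerD; rewrite normrM normr_nat -mulrA ler_wpM2l //
    (le_trans (ler_Im_normc _)) ?hC1 ?hC2.
have lim := cvg_integral_exp_dominated cW' hb.
have W0 : complex.Im (W 0) = 0.
  have e : cexp ((- 0 ^+ 2) +i* (- (0 * 0 ^+ 3 / 3))) = 1 :> R[i].
    by rewrite /cexp /= expr0n !mul0r oppr0 expR0 cos0 sin0 mul1r.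
  by rewrite /W e mulr1; case: (l) => [|j] //; rewrite exprS (_ : 0 +i* 0 = 0) // mul0r.
have lim0 : (\int[mu]_(s in `[0%R, T]) W' s)%R @[T --> +oo] --> (0 : R).
  have tail : C * expR (- T) @[T --> +oo] --> (0 : R).
    by rewrite -(mulr0 C); apply: cvgM; [exact: cvg_cst|exact: cvgr_expR].
  apply/cvgrPdist_le => e e0; move/cvgrPdist_le : tail => /(_ _ e0).
  apply: filterS2 (nbhs_pinfty_ge (num_real 0)) => T T0; rewrite !sub0r !normrN => hT.
  rewrite (Rintegral_FTC2 T0 dE cW') W0 subr0.
  apply: le_trans hT; apply: le_trans (ler_norm _); apply: le_trans (hC 0 T T0).
  apply: (le_trans (ler_Im_normc _)).
  rewrite -[gaussline 0 l T]/(W T * 'i%C) [leRHS]ComplexField.Normc.normcM.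
  by rewrite [normc 'i%C]/= expr0n expr1n add0r sqrtr1 mulr1.
have il j := integrable_gaussline 0 j.
have s1 := integrable_scale l%:R (measurable_itv _) (il l.-1).
have s2 := integrable_scale 2 (measurable_itv _) (il l.+1).
by rewrite -[RHS](cvg_unique _ lim lim0) // /gaussmom -!RintegralZl // -RintegralD.
Qed.

Lemma gaussmom00 : gaussmom 0 0 != 0.
Proof.
rewrite /gaussmom /Rintegral.
rewrite (_ : (\int[mu]_(x in _) _)%E =
  (\int[mu]_(x in `[0%R, +oo[) (gauss_fun x)%:E)%E); last first.
  apply: eq_integral => s _; congr (_%:E).
  by rewrite /gaussline /gauss_fun /cexp !mul0r oppr0 cos0 sin0 expr0 /=; ring.
rewrite integral0y_gauss /= gt_eqF // divr_gt0 // sqrtr_gt0.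
exact: pi_gt0.
Qed.

(** For Gaussian moments [hdet_string] holds with [a = c = 0] and [b = 2], so a zero of order [m.+2]
    would force one of order [m.+1]. The induction therefore carries two consecutive orders. *)
Lemma hdet_gaussmom0_neq0 m : hdet (gaussmom 0) m != 0.
Proof.
suff: hdet (gaussmom 0) m != 0 /\ hdet (gaussmom 0) m.+1 != 0 by case.
elim: m => [|m [h1 h2]].
  split; first by rewrite /hdet det_mx00 oner_eq0.
  by rewrite /hdet det_mx11 mxE gaussmom00.
split => //; apply/eqP => h3.
have rec k : k%:R * gaussmom 0 k.-1 + 0 * gaussmom 0 k + 2 * gaussmom 0 k.+1
    + 0 * gaussmom 0 k.+2 = 0.
  by rewrite -[RHS](gaussmom0_rec k); ring.
have := hdet_string m rec; rewrite h3 !mulr0 mul0r !addr0 => /eqP.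
by rewrite mulf_eq0 pnatr_eq0 /= expf_eq0 /= (negPf h2).
Qed.

End GaussianLimit.

(** * Nonvanishing of the even-order Hankel determinants of the real moments *)

Section HankelNonvanishing.
Variable R : realType.
Notation mu := (@lebesgue_measure R).
Local Notation normc := (@ComplexField.Normc.normc R).

Lemma Rintegral_lincomb (D : set R) n (c : nat -> R) (f : nat -> R -> R) : measurable D ->
  (forall l, mu.-integrable D (EFin \o f l)) ->
  mu.-integrable D (EFin \o (fun s => \sum_(l < n) c l * f l s)) /\
  (\int[mu]_(s in D) (\sum_(l < n) c l * f l s))%R = \sum_(l < n) c l * (\int[mu]_(s in D) f l s)%R.
Proof.
move=> mD fi; elim: n => [|n [IH1 IH2]].
  rewrite big_ord0; have -> : (fun s => \sum_(l < 0) c l * f l s) = cst 0.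
    by apply/funext => s; rewrite big_ord0.
  split; last by rewrite Rintegral_cst // mul0r.
  by rewrite (_ : EFin \o cst 0 = cst 0%E) //; exact: integrable0.
have -> : (fun s => \sum_(l < n.+1) c l * f l s) =
    (fun s => \sum_(l < n) c l * f l s + c n * f n s).
  by apply/funext => s; rewrite big_ord_recr.
have ic := integrable_scale (c n) mD (fi n).
split; first exact: integrable_add.
by rewrite RintegralD // IH2 RintegralZl // big_ord_recr.
Qed.

(** The power of [a + b (i s)] is expanded in powers of [i s]. The prefactor combines [b] from the
    line element with the value of the exponential at the saddle point [a]. *)
Lemma airyline_gauss (a b s : R) k : a * b ^+ 2 = 1 ->
  airyline (- a ^+ 2) k a b s = (b * expR (- (2 / 3) * a ^+ 3))%:C *
    \sum_(l < k.+1) (((a%:P + b *: 'X) ^+ k)`_l)%:C * gaussline (b ^+ 3) l s.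
Proof.
move=> ab; pose e := a%:P + b *: 'X : {poly R}.
have aX : (a +i* (b * s)) ^+ k = \sum_(l < k.+1) ((e ^+ k)`_l)%:C * (0 +i* s) ^+ l.
  have eE : map_poly (real_complex R) e = a%:C%:P + b%:C *: 'X.
    by rewrite /e raddfD /= map_polyC map_polyZ map_polyX.
  transitivity (map_poly (real_complex R) (e ^+ k)).[0 +i* s].
    rewrite rmorphXn /= eE !hornerE; congr (_ ^+ _).
    by simpc; rewrite ?add0r ?addr0 ?subr0.
  rewrite (@horner_coef_wide _ k.+1) ?size_map_poly ?size_affineX //.
  by apply: eq_bigr => l _; rewrite coef_map.
have cE : cexp ((a +i* (b * s)) ^+ 3 / 3%:R + (- a ^+ 2)%:C * (a +i* (b * s))) =
    (expR (- (2 / 3) * a ^+ 3))%:C * cexp ((- s ^+ 2) +i* (- (b ^+ 3 * s ^+ 3 / 3))).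
  have -> : (a +i* (b * s)) ^+ 3 / 3%:R + (- a ^+ 2)%:C * (a +i* (b * s)) =
      (- (2 / 3) * a ^+ 3 + - s ^+ 2) +i* (- (b ^+ 3 * s ^+ 3 / 3)).
    have -> : (3%:R : R[i]) = (3 : R)%:C by rewrite rmorph_nat.
    have n3 : (3 : R)%:C != 0 by rewrite eq_complex /= pnatr_eq0.
    apply: (mulIf n3); rewrite mulrDl divfK //.
    have -> : s ^+ 2 = a * (b * s) ^+ 2 by rewrite exprMn mulrA ab mul1r.
    by rewrite !exprS expr0; simpc; congr (_ +i* _); field.
  by rewrite /cexp /= expRD rmorphM mulrA.
rewrite /airyline /airyfun cE aX mulr_suml !mulr_suml mulr_sumr.
apply: eq_bigr => l _; rewrite /gaussline.
have -> : 0 +i* b = b%:C * 'i%C by simpc; rewrite ?mulr0 ?mulr1 ?mul0r ?subr0 ?addr0.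
by rewrite rmorphM; ring.
Qed.

Lemma airymom_gauss (a b : R) k : 1 <= a -> 0 < b -> a * b ^+ 2 = 1 ->
  airymom k (- a ^+ 2) = b * expR (- (2 / 3) * a ^+ 3) *
    momf (gaussmom (b ^+ 3)) ((a%:P + b *: 'X) ^+ k).
Proof.
move=> a1 b0 ab; rewrite (@airymomE _ k _ a b) //.
have il l := integrable_gaussline (b ^+ 3) l.
have [i1 i2] := Rintegral_lincomb k.+1 (fun l => ((a%:P + b *: 'X) ^+ k)`_l)
  (measurable_itv `[0%R, +oo[) il.
rewrite (@momfE _ _ k.+1) ?size_affineX //.
rewrite -i2 -RintegralZl //; apply: eq_Rintegral => s _.
rewrite airyline_gauss // cImM /= mul0r addr0; congr (_ * _).
rewrite (raddf_sum (@complex.Im R : {additive R[i] -> R})) /=.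
by apply: eq_bigr => l _; rewrite cImM /= mul0r addr0.
Qed.

Lemma hdet_airymom_gauss (a b : R) m : 1 <= a -> 0 < b -> a * b ^+ 2 = 1 ->
  hdet (fun k => airymom k (- a ^+ 2)) m = (b * expR (- (2 / 3) * a ^+ 3)) ^+ m *
    (\prod_(i < m) b ^+ i) ^+ 2 * hdet (gaussmom (b ^+ 3)) m.
Proof.
by move=> a1 b0 ab; apply: hdet_affine => k; exact: airymom_gauss.
Qed.

Lemma cvg_hdet (T : Type) (F : set_system T) {FF : Filter F} (nu : T -> nat -> R)
    (l : nat -> R) m :
  (forall k, nu x k @[x --> F] --> l k) -> hdet (nu x) m @[x --> F] --> hdet l m.
Proof.
move=> nul; rewrite /hdet /determinant.
apply: cvg_big => [|s _]; first exact: add_continuous.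
apply: cvgM; first exact: cvg_cst.
apply: cvg_big => [|i _]; first exact: mul_continuous.
by rewrite !mxE; under eq_fun do rewrite mxE; exact: nul.
Qed.

Let H m (delta : R) := hdet (fun k => airymom k delta) m.

Let H_derive m (delta : R) :
  is_derive delta 1 (H m) (hdet' (fun k => airymom k delta) m).
Proof. exact: is_derive_hdet (fun k => is_derive_airymom k delta). Qed.

Let H_string m (delta : R) : m.+1%:R * H m.+1 delta ^+ 2 +
  (H m delta * hdet' (fun k => airymom k delta) m.+2 -
   hdet' (fun k => airymom k delta) m * H m.+2 delta) = 0.
Proof.
have rec k : k%:R * airymom k.-1 delta + delta * airymom k delta +
    0 * airymom k.+1 delta + 1 * airymom k.+2 delta = 0.
  by rewrite mul0r addr0 mul1r airymom_rec.
by have := hdet_string m rec; rewrite mul0r addr0 mul1r.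
Qed.

(** By [H_string], the numerator in the quotient rule is - (m+1) times the square of [H m.+1], which
    fixes its sign. *)
Let ratio_derive m : (forall delta, H m delta != 0) -> forall delta : R,
  is_derive delta 1 (fun d => H m.+2 d / H m d)
    (- (m.+1%:R * (H m.+1 delta / H m delta) ^+ 2)).
Proof.
move=> Hm delta; have h1 := H_derive m.+2 delta.
have h2 := is_deriveV (Hm delta) (H_derive m delta).
apply: (@is_derive_eq _ _ _ _ _ _ _ _ (is_deriveM h1 h2)).
have := H_string m delta; set X := hdet' _ _; set Y := hdet' _ _ => E.
rewrite /GRing.scale /=.
have -> : m.+1%:R * (H m.+1 delta / H m delta) ^+ 2 =
    m.+1%:R * H m.+1 delta ^+ 2 / H m delta ^+ 2 by rewrite expr_div_n mulrA.
have -> : m.+1%:R * H m.+1 delta ^+ 2 = - (H m delta * X - Y * H m.+2 delta).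
  by apply/eqP; rewrite -addr_eq0 E.
by field; exact: Hm.
Qed.

Let is_derive_nincr (f df : R -> R) : (forall x : R, is_derive x 1 f (df x)) ->
  (forall x, df x <= 0) -> forall x y, x <= y -> f y <= f x.
Proof.
move=> fd df0 x y xy.
have [c _ e] := @MVT_segment _ f df x y xy (fun t _ => fd t)
  (continuous_subspaceT (fun t => is_derive_continuous (fd t))).
by rewrite -subr_le0 e mulr_le0_ge0 // subr_ge0.
Qed.

(** With [a * b ^+ 2 = 1] and [b] as parameter, [a] is b^(-2) and [delta] is - b^(-4), so [b]
    tending to 0 from the right describes [delta] tending to minus infinity. *)
Let H_asymp m b : 0 < b -> b <= 1 ->
  H m (- (b^-1 ^+ 2) ^+ 2) = (b * expR (- (2 / 3) * (b^-1 ^+ 2) ^+ 3)) ^+ m *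
    (\prod_(i < m) b ^+ i) ^+ 2 * hdet (gaussmom (b ^+ 3)) m.
Proof.
move=> b0 b1; apply: hdet_airymom_gauss => //.
  by rewrite exprn_ege1 // invf_ge1.
by rewrite -exprMn mulVf ?expr1n // gt_eqF.
Qed.

Let cvg_hgauss m : hdet (gaussmom (b ^+ 3)) m @[b --> 0^'+] --> hdet (gaussmom (0 : R)) m.
Proof.
have h : b ^+ 3 @[b --> (0 : R)^'+] --> (0 : R).
  have h : b ^+ 3 @[b --> (0 : R)] --> (0 : R).
    by have := @exprn_continuous R 3 0; rewrite /continuous_at expr0n.
  by apply: (cvg_trans _ h); apply: cvg_app; exact: cvg_within.
by apply: cvg_hdet => k; exact: (cvg_comp _ _ h (@cvg_gaussmom R k)).
Qed.

(** The prefactor of [H_asymp] never vanishes, and the Gaussian factor has a nonzero limit. *)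
Let H_near_neq0 m : \forall b \near (0 : R)^'+, H m (- (b^-1 ^+ 2) ^+ 2) != 0.
Proof.
near=> b.
have b0 : 0 < b by near: b; exact: nbhs_right_gt.
have b1 : b <= 1 by near: b; exact: nbhs_right_le.
have nz : hdet (gaussmom (b ^+ 3)) m != 0.
  by near: b; exact: (cvgr_neq0 _ (@cvg_hgauss m) (hdet_gaussmom0_neq0 R m)).
have s0 : b * expR (- (2 / 3) * (b^-1 ^+ 2) ^+ 3) != 0.
  by rewrite mulf_neq0 ?expR_eq0 // gt_eqF.
have P0 : \prod_(i < m) b ^+ i != 0.
  by apply/prodf_neq0 => i _; rewrite expf_neq0 // gt_eqF.
by rewrite H_asymp // mulf_neq0 // mulf_neq0 // expf_neq0.
Unshelve. all: by end_near. Qed.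

Let cvg_ratio m : H m.+2 (- (b^-1 ^+ 2) ^+ 2) / H m (- (b^-1 ^+ 2) ^+ 2)
  @[b --> (0 : R)^'+] --> (0 : R).
Proof.
have n0 := hdet_gaussmom0_neq0 R m.
have l1 : hdet (gaussmom (b ^+ 3)) m.+2 / hdet (gaussmom (b ^+ 3)) m @[b --> (0 : R)^'+] -->
    hdet (gaussmom (0 : R)) m.+2 / hdet (gaussmom (0 : R)) m.
  by apply: cvgM (@cvg_hgauss _) _; apply: cvgV.
(* The quotient of the prefactors of orders [m.+2] and [m]. It lies between 0 and [b] for
   [0 < b <= 1], while the quotient of the Gaussian factors has a finite limit. *)
pose q (b : R) := (b * expR (- (2 / 3) * (b^-1 ^+ 2) ^+ 3)) ^+ 2 * (b ^+ m * b ^+ m.+1) ^+ 2.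
have l2 : q b @[b --> (0 : R)^'+] --> (0 : R).
  apply: (@squeeze_cvgr _ _ _ _ (cst 0) id); [|exact: cvg_cst|exact: cvg_within].
  near=> b.
  have b0 : 0 < b by near: b; exact: nbhs_right_gt.
  have b1 : b <= 1 by near: b; exact: nbhs_right_le.
  rewrite /q mulr_ge0 ?sqr_ge0 //=.
  set e := expR _.
  have e1 : e <= 1.
    by rewrite -expR0 ler_expR mulNr oppr_le0 !mulr_ge0 ?exprn_ge0 // invr_ge0 ltW.
  have e0 : 0 <= e := expR_ge0 _.
  have be : b * e <= 1 by rewrite mulr_ile1 // ltW.
  have be0 : 0 <= b * e by rewrite mulr_ge0 // ltW.
  have k1 : (b * e) ^+ 2 <= b.
    by rewrite expr2 (le_trans (ler_piMr be0 be)) // ler_piMr // ltW.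
  rewrite (le_trans _ k1) // ler_piMr ?sqr_ge0 //.
  by rewrite exprn_ile1 ?mulr_ge0 ?exprn_ge0 ?mulr_ile1 ?exprn_ge0 ?exprn_ile1 // ltW.
have l3 := cvgM l2 l1; rewrite mul0r in l3.
apply: (cvg_trans _ (l3 _)); apply: near_eq_cvg; near=> b.
have b0 : 0 < b by near: b; exact: nbhs_right_gt.
have b1 : b <= 1 by near: b; exact: nbhs_right_le.
have nz : hdet (gaussmom (b ^+ 3)) m != 0.
  by near: b; exact: (cvgr_neq0 _ (@cvg_hgauss m) n0).
rewrite /= /q !H_asymp // !big_ord_recr /=.
set s := b * expR _; set P := \prod_(i < m) b ^+ i.
have s0 : s != 0 by rewrite mulf_neq0 ?expR_eq0 // gt_eqF.
have P0 : P != 0 by apply/prodf_neq0 => i _; rewrite expf_neq0 // gt_eqF.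
have -> : s ^+ m.+2 = s ^+ m * s ^+ 2 by rewrite -exprD addn2.
have sm : s ^+ m != 0 by rewrite expf_neq0.
by field; rewrite nz P0 sm.
Unshelve. all: by end_near. Qed.

Let near_le (x : R) : \forall b \near (0 : R)^'+, - (b^-1 ^+ 2) ^+ 2 <= x.
Proof.
(* Below this threshold the inverse of [b] is at least 1 + |x|, and so is its fourth power. *)
have x0 : 0 < (1 + `|x|)^-1 by rewrite invr_gt0 ltr_wpDr.
near=> b.
have b0 : 0 < b by near: b; exact: nbhs_right_gt.
have bx : b <= (1 + `|x|)^-1 by near: b; exact: nbhs_right_le.
have c1 : 1 + `|x| <= b^-1 by rewrite -[leLHS]invrK lef_pV2.
have c2 : 1 <= b^-1 by rewrite (le_trans _ c1) // lerDl.
have c3 : b^-1 <= (b^-1 ^+ 2) ^+ 2.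
  by rewrite -exprM exprS ler_peMr ?exprn_ege1 // (le_trans ler01).
by have := ler_norm (- x); rewrite normrN; lra.
Unshelve. all: by end_near. Qed.

Lemma hdet_airymom_neq0 n (delta : R) : hdet (fun k => airymom k delta) (2 * n) != 0.
Proof.
rewrite -/(H _ _); elim: n delta => [|n IH] delta.
  by rewrite muln0 /H /hdet det_mx00 oner_eq0.
rewrite mulnS add2n; set m := (2 * n)%N in IH *.
apply/negP => /eqP H0.
pose r d := H m.+2 d / H m d.
have r_nincr : forall x y, x <= y -> r y <= r x.
  apply: is_derive_nincr (ratio_derive IH) _ => x.
  by rewrite oppr_le0 mulr_ge0 ?sqr_ge0.
have rdelta : r delta = 0 by rewrite /r H0 mul0r.
(* At such a point left of [delta], monotonicity gives [r] at least [r delta], which is 0, and the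
   nonzero numerator makes it positive. *)
have [b [b_delta bH]] : exists b : R, - (b^-1 ^+ 2) ^+ 2 <= delta /\
    H m.+2 (- (b^-1 ^+ 2) ^+ 2) != 0.
  near (0 : R)^'+ => b; exists b; split; last by near: b; exact: H_near_neq0.
  by near: b; exact: near_le.
have r_gt0 : 0 < r (- (b^-1 ^+ 2) ^+ 2).
  by rewrite lt_neqAle -{2}rdelta r_nincr // andbT eq_sym mulf_neq0 ?invr_eq0.
(* Further to the left [r] must fall below this positive value, since it tends to 0, and must also
   stay above it by monotonicity. *)
near (0 : R)^'+ => c.
have : r (- (c^-1 ^+ 2) ^+ 2) < r (- (b^-1 ^+ 2) ^+ 2).
  by near: c; exact: cvgr_lt (@cvg_ratio m) _ r_gt0.
rewrite ltNge r_nincr //.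
by near: c; exact: near_le.
Unshelve. all: by end_near. Qed.

End HankelNonvanishing.

(** * Contour integrals *)

Section PiecewiseFTC.
Variable R : realType.
Notation mu := (@lebesgue_measure R).

Lemma integrable_setU2 (A B : set R) (f : R -> R) : measurable A -> measurable B ->
  [disjoint A & B] -> mu.-integrable A (EFin \o f) -> mu.-integrable B (EFin \o f) ->
  mu.-integrable (A `|` B) (EFin \o f).
Proof.
move=> mA mB AB /integrableP[mfA fA] /integrableP[mfB fB]; apply/integrableP.
have mf : measurable_fun (A `|` B) (EFin \o f) by apply/measurable_funU.
split => //; rewrite ge0_integral_setU //; first exact: lte_add_pinfty.
exact: measurableT_comp.
Qed.

(** The values of [f] at the endpoints are arbitrary, so [f] is replaced by the function [g]
    extended by its one-sided limits; the two differ on a null set only. *)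
Lemma FTC2_open_interval (F f : R -> R) (a b : R) : a < b ->
  continuous F ->
  (forall t, a < t < b -> is_derive t 1 F (f t) /\ {for t, continuous f}) ->
  cvg (f x @[x --> a^'+]) -> cvg (f x @[x --> b^'-]) ->
  mu.-integrable `[a, b] (EFin \o f) /\ (\int[mu]_(t in `[a, b]) f t)%R = F b - F a.
Proof.
move=> ab cF dF /cvg_ex[la hla] /cvg_ex[lb hlb].
pose g x := if x == a then la else if x == b then lb else f x.
have gf x : a < x < b -> g x = f x.
  by move=> /andP[ax xb]; rewrite /g gt_eqF // lt_eqF.
have ga : g x @[x --> a^'+] --> g a.
  rewrite {2}/g eqxx; apply: (cvg_trans _ hla); apply: near_eq_cvg; near=> x.
  rewrite gf //; apply/andP; split; first by near: x; exact: nbhs_right_gt.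
  by near: x; exact: nbhs_right_lt.
have gb : g x @[x --> b^'-] --> g b.
  rewrite {2}/g eqxx (gt_eqF ab); apply: (cvg_trans _ hlb); apply: near_eq_cvg; near=> x.
  rewrite gf //; apply/andP; split; last by near: x; exact: nbhs_left_lt.
  by near: x; exact: nbhs_left_gt.
have cg : {within `[a, b], continuous g}.
  apply/(continuous_within_itvP _ ab); split => // x; rewrite in_itv /= => xab.
  have [_ cf] := dF _ xab; rewrite /continuous_at gf //.
  apply: (cvg_trans _ cf); apply: near_eq_cvg; near=> y.
  rewrite gf //; near: y.
  have := near_in_itvoo (_ : x \in `]a, b[); rewrite !in_itv /= => /(_ xab).
  by apply: filterS => y; rewrite in_itv.
have ig : mu.-integrable `[a, b] (EFin \o g).
  by apply: continuous_compact_integrable => //; exact: segment_compact.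
pose N := [set a] `|` [set b].
have mN : measurable N by apply: measurableU; exact: measurable_set1.
have muN : mu N = 0%E.
  apply: countable_lebesgue_measure0; apply: finite_set_countable.
  by rewrite finite_setU; split; exact: finite_set1.
have fg : {in `[a, b]%classic `\` N, EFin \o g =1 EFin \o f}.
  move=> x; rewrite inE /= in_itv /= => -[/andP[ax xb] /not_orP[xa xb']].
  rewrite gf // !lt_neqAle ax xb !andbT; apply/andP; split; apply/eqP => // e.
  by apply: xa; rewrite e.
have mf : measurable_fun `[a, b] (EFin \o f).
  apply/measurable_EFinP; apply: (@measurable_fun_itv_cc _ a b false true).
  have mg : measurable_fun `]a, b[ g.
    apply/measurable_EFinP; apply: measurable_funS (measurable_int _ ig) => //.
    exact: subset_itv_oo_cc.
  apply: eq_measurable_fun mg => x; rewrite inE /= in_itv /=; exact: gf.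
have igN : mu.-integrable (`[a, b]%classic `\` N) (EFin \o g).
  by apply: integrableS ig => //; exact: measurableD.
have mab : measurable (`[a, b]%classic : set R) by [].
have if_ : mu.-integrable `[a, b] (EFin \o f).
  have ifN : mu.-integrable (`[a, b]%classic `\` N) (EFin \o f).
    apply: (@eq_integrable _ _ R mu _ _ (EFin \o g) (EFin \o f)) => //; exact: measurableD.
  exact: (@negligible_integrable _ _ _ mu _ _ _ mN mab mf muN).2 ifN.
split => //.
have dFg : derivable_oo_LRcontinuous F a b.
  split; [|exact: cvg_at_right_filter (cF a)|exact: cvg_at_left_filter (cF b)].
  by move=> x; rewrite in_itv /= => /dF[[]].
have dFE : {in `]a, b[, derive1 F =1 g}.
  move=> x; rewrite in_itv /= => xab.
  by rewrite gf // derive1E; have [/@derive_val] := dF _ xab.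
rewrite /Rintegral (@negligible_integral _ _ _ mu _ _ _ mN mab if_ muN).
have eI : (\int[mu]_(x in `[a, b]%classic `\` N) (f x)%:E =
    \int[mu]_(x in `[a, b]%classic `\` N) (g x)%:E)%E.
  by apply: eq_integral => x xD; rewrite -[(f x)%:E]fg.
rewrite [X in fine X]eI -(@negligible_integral _ _ _ mu _ _ _ mN mab ig muN).
by rewrite (continuous_FTC2 ab cg dFg dFE).
Unshelve. all: by end_near. Qed.

Lemma FTC2_piecewise (F f : R -> R) (D : set R) (a b : R) : a <= b ->
  finite_set (D `&` `[a, b]) -> continuous F ->
  (forall t, ~ D t -> is_derive t 1 F (f t) /\ {for t, continuous f}) ->
  (forall t, cvg (f x @[x --> t^'-]) /\ cvg (f x @[x --> t^'+])) ->
  mu.-integrable `[a, b] (EFin \o f) /\ (\int[mu]_(t in `[a, b]) f t)%R = F b - F a.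
Proof.
move=> ab /finite_seqP[s Ds] cF dF lf.
have {Ds} : forall t, a < t < b -> D t -> t \in s.
  move=> t /andP[at_ tb] Dt; suff : (D `&` `[a, b]) t by rewrite Ds.
  by split => //=; rewrite in_itv /= !ltW.
(* Each step splits the interval at one of the exceptional points. *)
elim: s a b ab => [|c s IH] a b ab hs.
  move: ab; rewrite le_eqVlt => /predU1P[->|ab].
    rewrite set_itv1 Rintegral_set1 subrr; split => //.
    have -> : [set b] = `[b, b]%classic by rewrite set_itv1.
    apply/integrableP; split.
      rewrite set_itv1; exact: measurable_fun_set1.
    by rewrite set_itv1 integral_set1 ltry.
  apply: FTC2_open_interval => //; [|by have [] := lf a|by have [] := lf b].
  by move=> t tab; apply: dF => /(hs _ tab).
have [/andP[ac cb]|cab] := boolP (a < c < b); last first.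
  apply: IH => // t tab Dt; have := hs t tab Dt; rewrite in_cons => /orP[/eqP tc|//].
  by rewrite -tc tab in cab.
have [i1 e1] : mu.-integrable `[a, c] (EFin \o f) /\
    (\int[mu]_(t in `[a, c]) f t)%R = F c - F a.
  apply: IH; first exact: ltW.
  move=> t /andP[at_ tc] Dt; have := hs t _ Dt; rewrite at_ (lt_trans tc cb) => /(_ isT).
  by rewrite in_cons (lt_eqF tc).
have [i2 e2] : mu.-integrable `[c, b] (EFin \o f) /\
    (\int[mu]_(t in `[c, b]) f t)%R = F b - F c.
  apply: IH; first exact: ltW.
  move=> t /andP[ct tb] Dt; have := hs t _ Dt; rewrite tb (lt_trans ac ct) => /(_ isT).
  by rewrite in_cons (gt_eqF ct).
have i2' : mu.-integrable `]c, b] (EFin \o f).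
  by apply: integrableS i2 => //; apply: subset_itvr; rewrite bnd_simp.
have i : mu.-integrable `[a, b] (EFin \o f).
  rewrite (@itv_bndbnd_setU _ _ (BLeft a) (BRight c) (BRight b)) ?bnd_simp ?ltW //.
  apply: integrable_setU2 => //.
  apply/disj_setPS => x /= []; rewrite !in_itv /= => /andP[_ xc] /andP[cx _].
  by move: cx; rewrite ltNge xc.
split => //.
have := @Rintegral_itvB _ f (BLeft a) (BRight b) c i; rewrite !bnd_simp (ltW ac) (ltW cb).
move=> /(_ isT isT) E.
have : (\int[mu]_(t in `]c, b]) f t)%R = F b - F c.
  by rewrite Rintegral_itv_obnd_cbnd.
by rewrite -E e1 => h; rewrite -[LHS](subrK (F c - F a)) h; ring.
Qed.

End PiecewiseFTC.

(** * Contour moments in terms of the real moments *)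

Section ContourMoments.
Variable R : realType.
Notation mu := (@lebesgue_measure R).
Local Notation normc := (@ComplexField.Normc.normc R).

Definition ccvg (T : Type) (F : set_system T) (u : T -> R[i]) (l : R[i]) : Prop :=
  complex.Re (u x) @[x --> F] --> complex.Re l /\
  complex.Im (u x) @[x --> F] --> complex.Im l.

Lemma ccvgM (T : Type) (F : set_system T) {FF : Filter F} (u v : T -> R[i]) (l m : R[i]) :
  ccvg F u l -> ccvg F v m -> ccvg F (fun x => u x * v x) (l * m).
Proof.
move=> [u1 u2] [v1 v2]; split; rewrite ?cReM ?cImM.
  by under eq_fun do rewrite cReM; apply: cvgB; apply: cvgM.
by under eq_fun do rewrite cImM; apply: cvgD; apply: cvgM.
Qed.

Lemma ccvg_cst (T : Type) (F : set_system T) {FF : Filter F} (c : R[i]) : ccvg F (fun=> c) c.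
Proof. by split; exact: cvg_cst. Qed.

Lemma ccvg_chol (T : Type) (F : set_system T) {FF : Filter F} (f f' : R[i] -> R[i])
    (u : T -> R[i]) (l : R[i]) : chol f f' -> lbounded f' ->
  ccvg F u l -> ccvg F (fun x => f (u x)) (f l).
Proof.
move=> hf bf' [u1 u2]; have [M M0 hM] := chol_lipschitz l hf bf'.
have near_l (e : R) : 0 < e -> \forall x \near F, normc (u x - l) <= e.
  move=> e0; have e2 : 0 < e / 2 by rewrite divr_gt0.
  move/cvgrPdist_le : u1 => /(_ _ e2) h1; move/cvgrPdist_le : u2 => /(_ _ e2) h2.
  apply: filterS2 h1 h2 => x h1 h2; rewrite (le_trans (normc_le_ReIm _)) //.
  rewrite cReD cImD (splitr e) lerD //; rewrite distrC in h1; rewrite distrC in h2.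
    by move: h1; case: (l).
  by move: h2; case: (l).
have small (e : R) : 0 < e -> \forall x \near F, normc (u x - l) <= 1 /\ M * normc (u x - l) <= e.
  move=> e0; have e1 : 0 < e / (M + 1) by rewrite divr_gt0 // ltr_wpDl.
  apply: filterS2 (near_l _ ltr01) (near_l _ e1) => x h1 h2; split => //.
  apply: (@le_trans _ _ ((M + 1) * normc (u x - l))).
    by rewrite ler_wpM2r ?normc_ge0 // lerDl.
  by rewrite mulrC -ler_pdivlMr // ltr_wpDl.
split; apply/cvgrPdist_le => e e0; apply: filterS (small e e0) => x [h1 h2];
  have [h3 h4] := hM _ h1; rewrite distrC; [exact: le_trans h3 h2|exact: le_trans h4 h2].
Qed.

Lemma cvg_one_sided (f : R -> R) (t : R) : {for t, continuous f} ->
  cvg (f x @[x --> t^'-]) /\ cvg (f x @[x --> t^'+]).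
Proof.
move=> cf; split; apply/cvg_ex; exists (f t);
  [exact: cvg_at_left_filter|exact: cvg_at_right_filter].
Qed.

Lemma piecewise_C1_one_sided (g : R -> R) : piecewise_C1 g -> forall t,
  cvg (derive1 g x @[x --> t^'-]) /\ cvg (derive1 g x @[x --> t^'+]).
Proof.
move=> [_ [D [_ Dn Dt]]] t; have [/Dt //|/Dn[_ h]] := pselect (D t).
exact: cvg_one_sided.
Qed.

Section Contour.
Variables (gamma : R -> R[i]) (delta : R) (k : nat).
Hypothesis hgamma : contour gamma.

Let f (z : R[i]) := z ^+ k * cexp ('i%C * (z ^+ 3 / 3%:R - delta%:C * z)).
(** Rotation by [- 'i] turns the contour into one in the right half-plane near its ends, with real
    part [Im gamma] and imaginary part [- Re gamma]. *)
Let zeta t := - 'i%C * gamma t.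
(** A primitive of the integrand along the contour: ['i ^+ k] comes from [fE], and one more ['i]
    from dz = i dzeta. *)
Let Z t := 'i%C ^+ k.+1 * airyprim delta k (zeta t).
Let psi t := f (gamma t) * cderive gamma t.

Let fE z : f z = 'i%C ^+ k * airyfun delta k (- 'i%C * z).
Proof.
have e1 : 'i%C ^+ k * (- 'i%C * z) ^+ k = z ^+ k.
  by rewrite -exprMn mulrA mulrN -expr2 sqr_i opprK mul1r.
rewrite /f /airyfun [RHS]mulrA e1; congr (_ * cexp _); rewrite exprMn.
have -> : (- 'i%C) ^+ 3 = 'i%C :> R[i].
  by rewrite exprS sqrrN sqr_i mulrN1 opprK.
ring.
Qed.

Let ccvg_zeta (F : set_system R) {FF : Filter F} (l : R[i]) :
  ccvg F gamma l -> ccvg F zeta (- 'i%C * l).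
Proof. by move=> h; apply: ccvgM h; exact: ccvg_cst. Qed.

Let gamma_continuous t : ccvg (nbhs t) gamma (gamma t).
Proof. by case: hgamma => -[cx _] [cy _] _ _; split; [exact: cx|exact: cy]. Qed.

Let ccvg_psi (F : set_system R) {FF : Filter F} (t : R) (dl : R[i]) :
  F --> t -> ccvg F (cderive gamma) dl -> ccvg F psi (f (gamma t) * dl).
Proof.
move=> Ft hd; apply: ccvgM hd.
under eq_fun do rewrite fE; rewrite fE.
apply: ccvgM; first exact: ccvg_cst.
apply: (ccvg_chol (@chol_airyfun R delta k) (@lbounded_airyfun' R delta k)).
apply: ccvg_zeta; have [h1 h2] := gamma_continuous t.
by split; [apply: cvg_trans h1|apply: cvg_trans h2]; apply: cvg_app.
Qed.

Let Z_continuous :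
  continuous (fun t => complex.Re (Z t)) /\ continuous (fun t => complex.Im (Z t)).
Proof.
have h t : ccvg (nbhs t) Z (Z t).
  apply: ccvgM; first exact: ccvg_cst.
  apply: (ccvg_chol (@chol_airyprim R delta k) (@lbounded_airyfun R delta k)).
  exact/ccvg_zeta/gamma_continuous.
by split=> t; have [] := h t.
Qed.

Let cis_derive_Z t : derivable (fun s => complex.Re (gamma s)) t 1 ->
  derivable (fun s => complex.Im (gamma s)) t 1 -> cis_derive t Z (psi t).
Proof.
move=> dx dy; have hg : cis_derive t gamma (cderive gamma t).
  by split; [apply: (DeriveDef dx)|apply: (DeriveDef dy)]; rewrite [RHS]derive1E.
have hz := cis_deriveM (cis_derive_cst t (- 'i%C)) hg.
apply: cis_derive_eq (cis_deriveM (cis_derive_cst t ('i%C ^+ k.+1))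
  (chol_airyprim delta k hz)) _.
rewrite !mul0r !add0r /psi fE exprSr.
have ii : 'i%C * 'i%C = -1 :> R[i] by rewrite -expr2 sqr_i.
rewrite -/(zeta t) (_ : _ * _ = - ('i%C * 'i%C) *
    ('i%C ^+ k * airyfun delta k (zeta t) * cderive gamma t)).
  by rewrite ii opprK mul1r.
ring.
Qed.

Let psi_one_sided t :
  (cvg (complex.Re (psi x) @[x --> t^'-]) /\ cvg (complex.Re (psi x) @[x --> t^'+])) /\
  (cvg (complex.Im (psi x) @[x --> t^'-]) /\ cvg (complex.Im (psi x) @[x --> t^'+])).
Proof.
case: hgamma => hx hy _ _.
have [/cvg_ex[xl hxl] /cvg_ex[xr hxr]] := piecewise_C1_one_sided hx t.
have [/cvg_ex[yl hyl] /cvg_ex[yr hyr]] := piecewise_C1_one_sided hy t.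
have [l1 l2] : ccvg t^'- psi (f (gamma t) * (xl +i* yl)).
  by apply: ccvg_psi; [exact: cvg_within|split].
have [r1 r2] : ccvg t^'+ psi (f (gamma t) * (xr +i* yr)).
  by apply: ccvg_psi; [exact: cvg_within|split].
by do !split; apply/cvg_ex; eexists; [exact: l1|exact: r1|exact: l2|exact: r2].
Qed.

(** On a bounded interval the two coordinates have finitely many corners in total, so the piecewise
    fundamental theorem applies to both parts of [Z]. *)
Lemma cintegral_contour (a b : R) : a <= b -> cintegral psi a b = Z b - Z a.
Proof.
move=> ab; case: (hgamma) => -[_ [D1 [fin1 n1 _]]] [_ [D2 [fin2 n2 _]]] _ _.
have fin : finite_set ((D1 `|` D2) `&` `[a, b]).
  by rewrite setIUl finite_setU; split.
have dZ t : ~ (D1 `|` D2) t -> cis_derive t Z (psi t) /\ ccvg (nbhs t) psi (psi t).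
  move=> /not_orP[nD1 nD2]; have [dx cx] := n1 _ nD1; have [dy cy] := n2 _ nD2.
  have cd : ccvg (nbhs t) (cderive gamma) (cderive gamma t) := conj cx cy.
  by split; [exact: (cis_derive_Z dx dy)|exact: (ccvg_psi (@cvg_id _ (nbhs t)) cd)].
have [c1 c2] := Z_continuous.
have [_ e1] := @FTC2_piecewise R (fun t => complex.Re (Z t)) (fun t => complex.Re (psi t))
  _ a b ab fin c1 (fun t nt => conj (dZ t nt).1.1 (dZ t nt).2.1) (fun t => (psi_one_sided t).1).
have [_ e2] := @FTC2_piecewise R (fun t => complex.Im (Z t)) (fun t => complex.Im (psi t))
  _ a b ab fin c2 (fun t nt => conj (dZ t nt).1.2 (dZ t nt).2.2) (fun t => (psi_one_sided t).2).
by rewrite /cintegral e1 e2; case: (Z a) (Z b) => ? ? [].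
Qed.

Let ccvg_end (F : set_system R) {FF : Filter F} (X : R -> R) (theta : R) :
  0 < sin theta -> sin theta < cos theta ->
  (cmod (gamma t) @[t --> F] --> +oo) ->
  X t / cmod (gamma t) @[t --> F] --> cos theta ->
  complex.Im (gamma t) / cmod (gamma t) @[t --> F] --> sin theta ->
  ccvg F (fun t => airyprim delta k (complex.Im (gamma t) +i* X t)) (airylim delta k 1 1).
Proof.
(* The midpoint [m] separates the limits of [Im gamma] and [X] over the modulus, so eventually
   [Im gamma <= X]; the bound by half of [sin theta] gives [1 <= Im gamma]. This places the points
   in the sector. *)
move=> s0 sc Noo Xc Ys; set m := (sin theta + cos theta) / 2.
have m0 : 0 < m by rewrite /m; lra.
have sh : 0 < sin theta / 2 by rewrite divr_gt0.
have N1 : \forall t \near F, 2 / sin theta <= cmod (gamma t).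
  by move/cvgryPge : Noo; exact.
have N0 : \forall t \near F, 0 < cmod (gamma t).
  by apply: filterS N1 => t; apply: lt_le_trans; rewrite divr_gt0.
have XN : \forall t \near F, m * cmod (gamma t) <= X t.
  have h : \forall t \near F, m < X t / cmod (gamma t).
    by apply: (cvgr_gt _ Xc); rewrite /m; lra.
  by apply: filterS2 N0 h => t n0; rewrite ltr_pdivlMr // => /ltW.
have YN : \forall t \near F, sin theta / 2 * cmod (gamma t) <= complex.Im (gamma t).
  have h : \forall t \near F, sin theta / 2 < complex.Im (gamma t) / cmod (gamma t).
    by apply: (cvgr_gt _ Ys); lra.
  by apply: filterS2 N0 h => t n0; rewrite ltr_pdivlMr // => /ltW.
have YN' : \forall t \near F, complex.Im (gamma t) <= m * cmod (gamma t).
  have h : \forall t \near F, complex.Im (gamma t) / cmod (gamma t) < m.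
    by apply: (cvgr_lt _ Ys); rewrite /m; lra.
  by apply: filterS2 N0 h => t n0; rewrite ltr_pdivrMr // => /ltW.
apply: cvg_airyprim_region.
  apply: filterS3 (filterI N1 XN) YN YN' => t [n1 xn] yn yn'.
  rewrite (le_trans _ xn) // andbT (le_trans _ yn) //.
  by rewrite -ler_pdivrMl // invf_div mulr1.
apply/cvgryPge => A; move/cvgryPge : Noo => /(_ (A / m)) h.
apply: filterS2 h XN => t h xn; rewrite (le_trans _ xn) // mulrC.
by rewrite -ler_pdivrMr.
Qed.

(** The primitive tends to [L] at the left end and, by conjugation symmetry, to its conjugate at the
    right end. The integral is thus i^(k+1) (conj L - L), which equals 2 i^k Im L. *)
Lemma moment_airymom :
  moment gamma delta k = 2%:R * 'i%C ^+ k * (airymom k delta)%:C.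
Proof.
have p6 : 0 < (pi : R) / 6 < (pi : R) by have h := @pi_gt0 R; apply/andP; split; lra.
have s0 : 0 < sin (pi / 6) :> R by exact: sin_gt0_pi.
have sc : sin (pi / 6) < cos (pi / 6) :> R.
  rewrite -cosBpihalf -cosN ltr_cos ?in_itv /=; have := @pi_gt0 R; lra.
case: (hgamma) => _ _ [NN cN sN] [Np cp sp].
(* The left direction mirrors the right one in the imaginary axis, so [- Re gamma] plays at the left
   end the role of [Re gamma] at the right end. *)
have e56 : 5 * pi / 6 = - (pi / 6) + pi :> R by field.
rewrite e56 cosDpi cosN in cN; rewrite e56 sinDpi sinN opprK in sN.
have cN' : - complex.Re (gamma t) / cmod (gamma t) @[t --> -oo] --> cos (pi / 6).
  have h := cvgN cN; rewrite opprK in h; apply: (cvg_trans _ (h _)).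
  by apply: near_eq_cvg; apply: nearW => t; rewrite [RHS]mulNr.
have LN := @ccvg_end (ninfty_nbhs R) _ (fun t => - complex.Re (gamma t)) _ s0 sc NN cN' sN.
have Lp := @ccvg_end (pinfty_nbhs R) _ (fun t => complex.Re (gamma t)) _ s0 sc Np cp sp.
set L := airylim delta k 1 1 in LN Lp.
have ZN : ccvg (ninfty_nbhs R) Z ('i%C ^+ k.+1 * L).
  have -> : Z = fun t => 'i%C ^+ k.+1 *
      airyprim delta k (complex.Im (gamma t) +i* (- complex.Re (gamma t))).
    apply/funext => t; rewrite /Z /zeta; case: (gamma t) => x y /=.
    by congr (_ * airyprim _ _ _); simpc.
  exact: (ccvgM (ccvg_cst ('i%C ^+ k.+1)) (LN _)).
have Zp : ccvg (pinfty_nbhs R) Z ('i%C ^+ k.+1 * L^*%C).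
  have -> : Z = fun t => 'i%C ^+ k.+1 *
      (airyprim delta k (complex.Im (gamma t) +i* complex.Re (gamma t)))^*%C.
    apply/funext => t; rewrite /Z /zeta -airyprim_conj; case: (gamma t) => x y /=.
    by congr (_ * airyprim _ _ _); simpc.
  apply: ccvgM; first exact: ccvg_cst.
  case: (Lp _) => l1 l2; split; rewrite ?Re_conjc ?Im_conjc.
    by under eq_fun do rewrite Re_conjc.
  by under eq_fun do rewrite Im_conjc; exact: cvgN.
pose FP := filter_prod (ninfty_nbhs R) (pinfty_nbhs R).
have near_ab : \forall ab \near FP, cintegral psi ab.1 ab.2 = Z ab.2 - Z ab.1.
  exists ([set a | a <= 0], [set b | 0 <= b]) => /=.
    (* Restricting to [a <= 0 <= b] ensures [a <= b], as the evaluation of the integral requires. *)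
    by split; [exact: nbhs_ninfty_le|exact: nbhs_pinfty_ge].
  by move=> [a b] /= [a0 b0]; rewrite cintegral_contour // (le_trans a0).
have [zn1 zn2] := ZN; have [zp1 zp2] := Zp.
have l1 : complex.Re (cintegral psi ab.1 ab.2) @[ab --> FP] -->
    complex.Re ('i%C ^+ k.+1 * L^*%C) - complex.Re ('i%C ^+ k.+1 * L).
  apply: (cvg_trans _ (cvgB (cvg_comp _ _ cvg_snd zp1) (cvg_comp _ _ cvg_fst zn1))).
  apply: near_eq_cvg; apply: filterS near_ab => ab ->.
  by rewrite cReD /= !fctE /=; case: (Z ab.1).
have l2 : complex.Im (cintegral psi ab.1 ab.2) @[ab --> FP] -->
    complex.Im ('i%C ^+ k.+1 * L^*%C) - complex.Im ('i%C ^+ k.+1 * L).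
  apply: (cvg_trans _ (cvgB (cvg_comp _ _ cvg_snd zp2) (cvg_comp _ _ cvg_fst zn2))).
  apply: near_eq_cvg; apply: filterS near_ab => ab ->.
  by rewrite cImD /= !fctE /=; case: (Z ab.1).
rewrite /moment /contour_integral /improper_cintegral -/f -/psi -/FP.
rewrite (cvg_lim _ l1) // (cvg_lim _ l2) //.
rewrite /airymom -/L exprSr.
rewrite -[2%:R : R[i]](rmorph_nat (real_complex R)).
case: ('i%C ^+ k) (L) => u v [p q]; rewrite !(cReM, cImM) /=; simpc => /=.
by congr (_ +i* _); ring.
Qed.

End Contour.
End ContourMoments.

Theorem theorem1p1 (R : realType) (gamma : R -> complex R)
    (hgamma : contour gamma) (n : nat) (hn : (1 <= n)%N) (delta : R) :
  hankel_det gamma delta (2 * n)%N <> 0%R.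
Proof.
pose nu k := (airymom k delta)%:C.
(* The factors ['i ^+ k] amount to the substitution of ['i *: 'X] for ['X], so by [hdet_affine] the
   complex determinant is a nonzero constant times the real one. *)
have momentE k : moment gamma delta k = 2%:R * momf nu ((0%:P + 'i%C *: 'X) ^+ k).
  rewrite moment_airymom // polyC0 add0r exprZn linearZ /= momfXn.
  by rewrite -mulrA.
apply/eqP; rewrite /hankel_det -/(hdet _ _) (hdet_affine _ momentE).
have i0 : 'i%C != 0 :> R[i] by rewrite eq_complex /= oner_eq0 andbF.
have -> : hdet nu (2 * n) = (hdet (fun k => airymom k delta) (2 * n))%:C.
  rewrite /hdet -det_map_mx; congr (\det _).
  by apply/matrixP => i j; rewrite !mxE.
have P0 : \prod_(i < 2 * n) 'i%C ^+ i != 0 :> R[i].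
  by apply/prodf_neq0 => i _; rewrite expf_neq0.
rewrite mulf_neq0 //; first by rewrite mulf_neq0 // expf_neq0 // pnatr_eq0.
by rewrite eq_complex /= eqxx andbT hdet_airymom_neq0.
Qed.
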